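(* Let $n,l\in\mathbb N$, and let $\varphi:\mathbb R\to\mathbb R$ be a continuous function that is not of the form $x\mapsto ax+b$ with $a,b\in\mathbb R$. Suppose there exist $a_1,b_1,a_2,b_2\in\mathbb R$ such that $\lim_{x\to\infty}(\varphi(x)-a_1x-b_1)=0$ and $\lim_{x\to-\infty}(\varphi(x)-a_2x-b_2)=0$. Then $$C_0(\mathbb R^n)\subseteq\overline{\mathcal N_\varphi^l(\mathbb R^n)}.$$
   Context: $\mathbb N=\{1,2,\ldots\}$. $C_0(\mathbb R^n)$ is the space of continuous functions $f:\mathbb R^n\to\mathbb R$ with $\lim_{\|x\|\to\infty}f(x)=0$. For a function $\varphi:\mathbb R\to\mathbb R$ define the real vector spaces of functions $\mathbb R^n\to\mathbb R$ $$\mathcal N_\varphi^1(\mathbb R^n):=\operatorname{span}\{x\mapsto\varphi(a\cdot x+b)\mid a\in\mathbb R^n,\ b\in\mathbb R\},$$ and, recursively for $l\ge2$, $$\mathcal N_\varphi^l(\mathbb R^n):=\operatorname{span}\{x\mapsto\varphi(f(x)+b)\mid f\in\mathcal N_\varphi^{l-1}(\mathbb R^n),\ b\in\mathbb R\},$$ where span is the $\mathbb R$-linear span and $a\cdot x$ is the Euclidean inner product. For a set $S$ of functions $\mathbb R^n\to\mathbb R$ (possibly unbounded), $\overline S$ is its uniform closure: $h\in\overline S$ iff for every $\epsilon>0$ there is $s\in S$ with $\sup_{x\in\mathbb R^n}|h(x)-s(x)|<\epsilon$. *)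

(* Defs.v *)
From HB Require Import structures.
From mathcomp Require Import all_boot all_order all_algebra.
From mathcomp Require Import all_classical all_reals all_analysis.

Set Implicit Arguments.
Unset Strict Implicit.
Unset Printing Implicit Defensive.

Import Order.TTheory GRing.Theory Num.Theory.
Import numFieldNormedType.Exports.

Local Open Scope classical_set_scope.
Local Open Scope ring_scope.

Definition dotv (R : realType) (n : nat) (a x : 'rV[R]_n) : R :=
  \sum_(i < n) a 0 i * x 0 i.

(* The library norm `|x| on 'rV[R]_n is the max norm, which induces the
   topology used by [continuous]; this is the Euclidean norm. *)
Definition enorm (R : realType) (n : nat) (x : 'rV[R]_n) : R :=
  Num.sqrt (dotv x x).

Definition C0 (R : realType) (n : nat) : set ('rV[R]_n -> R) :=
  [set f | continuous f /\
    forall eps : R, 0 < eps ->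
      exists M : R, forall x : 'rV[R]_n, M < enorm x -> `|f x| < eps].
Arguments C0 : clear implicits.

Definition fun_span (R : realType) (T : Type) (S : set (T -> R)) :
    set (T -> R) :=
  [set h | exists (k : nat) (c : 'I_k -> R) (g : 'I_k -> T -> R),
    (forall i, S (g i)) /\ h = (fun x => \sum_(i < k) c i * g i x)].

(* [networks phi n l] is meaningful for l >= 1 only; the value at l = 0 is
   a dummy, not used by the recursion. *)
Fixpoint networks (R : realType) (phi : R -> R) (n l : nat) :
    set ('rV[R]_n -> R) :=
  match l with
  | 0%N => set0
  | 1%N => fun_span [set g | exists (a : 'rV[R]_n) (b : R),
                             g = (fun x => phi (dotv a x + b))]
  | (_.+1 as l').+1 =>
         fun_span [set g | exists (f : 'rV[R]_n -> R) (b : R),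
                             networks phi l' f /\
                             g = (fun x => phi (f x + b))]
  end.
Arguments networks {R} phi n l.

(* The supremum is taken in the extended reals, so that it is +oo when the
   difference is unbounded. *)
Definition uniform_closure (R : realType) (T : Type) (S : set (T -> R)) :
    set (T -> R) :=
  [set h | forall eps : R, 0 < eps ->
    exists2 s, S s &
      (ereal_sup (range (fun x => `|h x - s x|%:E)) < eps%:E)%E].

(* Main.v *)
(* Every nonzero second difference [eta] of [phi] vanishes at infinity.  Smooth
   it into [g] with [g''] in the closed span [V] of the functions
   [phi (a x + b)] and put the maximum of [g] at the origin.  As [V] is
   invariant under dilations, it contains
     (g x - g 0) / x^2 = \int_0^1 (1 - s) g''(s x) ds,
   hence the nonnegative integrable kernel [(g 0 - g x) / x^2], an approximate
   identity: [V] contains [C_0(R)].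

   In several variables, the divided difference of [t / (1 + t^2)] at two affine
   forms is an average of ridge functions, and taking it at [(u, v)] and
   [(u, - v)] yields the product of [1 / (1 + u^2)] and [1 / (1 + v^2)].  So the
   closed span of the functions [1 / (1 + (a.x + b)^2)] is an algebra; it
   contains the products of tents in the coordinates, hence [C_0(R^n)].

   For deeper networks, write [f] as [g (f)] with [g] in [C_0(R)] the identity on
   the range of [f], approximate [g] by the functions [phi (a t + b)] and [a f] by
   networks with one layer fewer; [phi] is uniformly continuous. *)
Require Import Defs.
From mathcomp Require Import all_boot all_order all_algebra.
From mathcomp Require Import all_classical all_reals all_analysis.
From mathcomp Require Import ring lra.

Import Order.TTheory GRing.Theory Num.Theory.
Import numFieldNormedType.Exports.

Local Open Scope classical_set_scope.
Local Open Scope ring_scope.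

Set Implicit Arguments.
Unset Strict Implicit.
Unset Printing Implicit Defensive.

(** * Uniform closure, closed subspaces and closed spans *)

(** Halving [e] turns a pointwise bound into a strict bound on the supremum, so extended reals are
    left behind here. *)
Lemma uniform_closureP (R : realType) (T : Type) (S : set (T -> R))
    (h : T -> R) :
  uniform_closure S h <->
  forall e : R, 0 < e -> exists2 s, S s & forall x, `|h x - s x| <= e.
Proof.
split=> H e e0.
  have [s Ss hs] := H e e0; exists s => // x.
  rewrite -lee_fin; apply: le_trans (ltW hs).
  by apply: ereal_sup_ubound; exists x.
have e20 : 0 < e / 2 by rewrite divr_gt0.
have [s Ss hs] := H _ e20; exists s => //.
apply: (@le_lt_trans _ _ (e / 2)%:E); last by rewrite lte_fin; lra.
by apply: ge_ereal_sup => _ [x _ <-]; rewrite lee_fin.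
Qed.

(** A set of functions on a bare type, without a norm, since the members may be unbounded. *)
Definition closed_subspace (R : realType) (T : Type) (V : set (T -> R)) :=
  [/\ V (fun=> 0),
      forall f g, V f -> V g -> V (fun x => f x + g x),
      forall c f, V f -> V (fun x => c * f x) &
      uniform_closure V `<=` V].

Definition closed_span (R : realType) (T : Type) (S : set (T -> R)) :=
  uniform_closure (fun_span S).

Lemma fun_span_sub (R : realType) (T : Type) (S : set (T -> R)) :
  S `<=` fun_span S.
Proof.
move=> f Sf; exists 1%N, (fun=> 1), (fun=> f); split => //.
by apply/funext => x; rewrite big_ord1 mul1r.
Qed.

Lemma sub_closed_span (R : realType) (T : Type) (S : set (T -> R)) :
  S `<=` closed_span S.
Proof.
move=> f Sf; apply/uniform_closureP => e e0; exists f.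
  exact: fun_span_sub.
by move=> x; rewrite subrr normr0 ltW.
Qed.

Lemma closed_subspace_sum (R : realType) (T : Type) (V : set (T -> R))
    (I : Type) (r : seq I) (P : pred I) (F : I -> T -> R) :
  closed_subspace V -> (forall i, P i -> V (F i)) ->
  V (fun x => \sum_(i <- r | P i) F i x).
Proof.
move=> [V0 VD _ _] VF.
rewrite (_ : (fun x => _) = \big[(fun f g x => f x + g x)/(fun=> 0)]_(i <- r | P i) F i).
  by elim/big_ind : _.
apply/funext => x.
by elim/big_rec2 : _ => // i y f _ ->.
Qed.

(** The induction principle for closed spans: a property that defines a closed subspace and holds
    for the generators holds throughout. *)
Lemma closed_span_min (R : realType) (T : Type) (S V : set (T -> R)) :
  closed_subspace V -> S `<=` V -> closed_span S `<=` V.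
Proof.
move=> cV SV h /uniform_closureP Sh; have [_ _ VZ] := cV; apply.
apply/uniform_closureP => e e0; have [s + hs] := Sh e e0.
move=> [k [c [g [gS sE]]]]; exists s => //; rewrite sE.
by apply: closed_subspace_sum => // i _; apply/VZ/SV/gS.
Qed.

Lemma closed_span_subspace (R : realType) (T : Type) (S : set (T -> R)) :
  closed_subspace (closed_span S).
Proof.
have span0 : fun_span S (fun=> 0).
  exists 0%N, (fun=> 0), (fun=> fun=> 0); split; first by case.
  by apply/funext => x; rewrite big_ord0.
have spanD f g : fun_span S f -> fun_span S g ->
    fun_span S (fun x => f x + g x).
  move=> [k1 [c1 [g1 [Sg1 ->]]]] [k2 [c2 [g2 [Sg2 ->]]]].
  exists (k1 + k2)%N.
  exists (fun i => match fintype.split i with inl j => c1 j | inr j => c2 j end).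
  exists (fun i => match fintype.split i with inl j => g1 j | inr j => g2 j end).
  split; first by move=> i; case: fintype.split.
  apply/funext => x; rewrite big_split_ord /=; congr (_ + _).
    by apply: eq_bigr => i _; rewrite (unsplitK (inl i)).
  by apply: eq_bigr => i _; rewrite (unsplitK (inr i)).
have spanZ a f : fun_span S f -> fun_span S (fun x => a * f x).
  move=> [k [c [g [Sg ->]]]]; exists k, (fun i => a * c i), g; split => //.
  by apply/funext => x; rewrite mulr_sumr; apply: eq_bigr => i _; rewrite mulrA.
split.
- apply/uniform_closureP => e e0; exists (fun=> 0) => // x.
  by rewrite subrr normr0 ltW.
- move=> f g /uniform_closureP Sf /uniform_closureP Sg.
  apply/uniform_closureP => e e0.
  have e20 : 0 < e / 2 by rewrite divr_gt0.
  have [s Ss fs] := Sf _ e20; have [t St gt] := Sg _ e20.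
  exists (fun x => s x + t x); first exact: spanD.
  move=> x; rewrite opprD addrACA [leRHS]splitr.
  by apply: le_trans (ler_normD _ _) _; rewrite lerD.
- move=> c f /uniform_closureP Sf; apply/uniform_closureP => e e0.
  (* Adding 1 keeps the divisor positive when [c = 0]. *)
  have c0 : 0 < `|c| + 1 by rewrite ltr_wpDl.
  have [s Ss fs] := Sf _ (divr_gt0 e0 c0).
  exists (fun x => c * s x); first exact: spanZ.
  move=> x; rewrite -mulrBr normrM.
  apply: (@le_trans _ _ ((`|c| + 1) * (e / (`|c| + 1)))).
    by apply: ler_pM => //; rewrite lerDl.
  by rewrite mulrCA divff ?mulr1 // gt_eqF.
- move=> f /uniform_closureP Sf; apply/uniform_closureP => e e0.
  have e20 : 0 < e / 2 by rewrite divr_gt0.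
  have [g /uniform_closureP Sg fg] := Sf _ e20.
  have [s Ss gs] := Sg _ e20; exists s => // x.
  rewrite [leRHS]splitr -(subrKA (g x)).
  by apply: le_trans (ler_normD _ _) _; rewrite lerD.
Qed.

(** Together with [closed_span_min], this carries membership through the substitution [u] by
    checking generators only. *)
Lemma closed_subspace_comp (R : realType) (T U : Type) (V : set (U -> R))
    (u : U -> T) :
  closed_subspace V -> closed_subspace [set f : T -> R | V (f \o u)].
Proof.
move=> [V0 VD VZ VC]; split => //.
- by move=> f g; exact: VD.
- by move=> c f; exact: VZ.
- move=> f /uniform_closureP Vf; apply: VC; apply/uniform_closureP => e e0.
  by have [s Vs fs] := Vf e e0; exists (s \o u) => // x; exact: fs.
Qed.

(** * Uniform continuity on compact sets, mean values and Riemann sums *)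

(** Only [x] is confined to [A]; later uses have [y] near [A] but possibly outside. Each point of
    [A] has a radius that serves all nearby centres, and compactness yields a common one. *)
Lemma compact_uniform_continuity (R : realType) (T : normedModType R)
    (f : T -> R) (A : set T) :
  continuous f -> compact A -> forall e : R, 0 < e ->
  exists2 d : R, 0 < d &
    forall x y, A x -> `|x - y| < d -> `|f x - f y| < e.
Proof.
move=> cf /compact_near_coveringP cA e e0.
have : \forall d \near 0^'+, forall x, A x ->
    (forall y, `|x - y| < d -> `|f x - f y| < e).
  apply: cA => x Ax.
  have e20 : 0 < e / 2 by rewrite divr_gt0.
  have /cvgrPdist_lt/(_ _ e20)/nbhs_ballP[d d0 fd] := cf x.
  have d20 : 0 < d / 2 by rewrite divr_gt0.
  exists (ball x (d / 2), [set t : R | t <= d / 2]) => /=.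
    split; first exact: nbhsx_ballx.
    exact: nbhs_right_le.
  move=> [z t] /= [xz td] y zy.
  have fz : `|f x - f z| < e / 2.
    by apply: fd; apply: le_ball xz; lra.
  have fy : `|f x - f y| < e / 2.
    apply: fd; rewrite -ball_normE /ball_ /= in xz *.
    rewrite -(subrKA z) (splitr d).
    by apply: le_lt_trans (ler_normD _ _) _; rewrite ltrD // (lt_le_trans zy).
  rewrite -(subrKA (f x)) [ltRHS]splitr.
  by apply: le_lt_trans (ler_normD _ _) _; rewrite ltrD // distrC.
move=> nA.
have [d [/= d0 Ad]] : exists d : R, 0 < d /\
    forall x, A x -> forall y, `|x - y| < d -> `|f x - f y| < e.
  by apply: (@filter_ex _ (0:R)^'+); apply: filterI nA; exact: nbhs_right_gt.
by exists d => // x y /Ad; exact.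
Qed.

Lemma MVT_is_derive (R : realType) (f df : R -> R) (a b : R) : a < b ->
  (forall x, a <= x <= b -> is_derive x 1 f (df x)) ->
  exists2 c, a < c < b & f b - f a = df c * (b - a).
Proof.
move=> ab fdf.
have [||c] := @MVT R f df a b ab.
- by move=> x; rewrite in_itv /= => /andP[/ltW ? /ltW ?]; apply: fdf; apply/andP.
- apply: derivable_within_continuous => x; rewrite in_itv /= => /fdf.
  by move=> fx; exact: ex_derive.
by rewrite in_itv /= => cab E; exists c.
Qed.

(** The increment of [F] telescopes over the nodes and the mean value theorem applies on each cell,
    so no integral occurs. The error [e j] depends on the cell, to allow bounds by total
    variation. *)
Lemma riemann_sum_error (R : realType) (a b : R) (F D : R -> R) (m : nat)
    (e : nat -> R) (t := fun j : nat => a + (b - a) * (j%:R / m%:R)) :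
  a < b -> (0 < m)%N ->
  (forall s, a <= s <= b -> is_derive s 1 F (D s)) ->
  (forall j s, (j < m)%N -> t j <= s <= t j.+1 -> `|D s - D (t j)| <= e j) ->
  `|F b - F a - (b - a) / m%:R * \sum_(j < m) D (t j)|
    <= (b - a) / m%:R * \sum_(j < m) e j.
Proof.
move=> ab m0 FD De.
have m0' : 0 < m%:R :> R by rewrite ltr0n.
have tm : t m = b by rewrite /t divff ?gt_eqF // mulr1 addrC subrK.
have t0 : t 0%N = a by rewrite /t mul0r mulr0 addr0.
have -> : F b - F a = \sum_(j < m) (F (t j.+1) - F (t j)).
  by rewrite -(big_mkord xpredT (fun j => F (t j.+1) - F (t j))) telescope_sumr // tm t0.
rewrite !mulr_sumr -sumrB.
apply: le_trans (ler_norm_sum _ _ _) _; apply: ler_sum => j _.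
have tS i : t i.+1 - t i = (b - a) / m%:R.
  rewrite /t; field; by rewrite gt_eqF.
have d0 : 0 < (b - a) / m%:R by rewrite divr_gt0 // subr_gt0.
have tmono i k : (i <= k)%N -> t i <= t k.
  move=> ik; rewrite lerD2l ler_wpM2l //; first by rewrite subr_ge0 ltW.
  by rewrite ler_pM2r ?invr_gt0 // ler_nat.
have aj : a <= t j by rewrite -t0 tmono.
have jb : t j.+1 <= b by rewrite -tm tmono.
have jj : t j < t j.+1 by rewrite -subr_gt0 tS.
have [|c /andP[c1 c2] ->] := @MVT_is_derive _ F D _ _ jj.
  by move=> x /andP[x1 x2]; apply: FD; rewrite (le_trans aj x1) (le_trans x2 jb).
rewrite tS mulrC -mulrBr normrM gtr0_norm //.
by apply: ler_wpM2l; [exact: ltW|apply: De => //; rewrite !ltW].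
Qed.

(** * Functions vanishing at infinity on the line *)

(** The space $C_0(\mathbb R)$, stated on [R] itself instead of on rows of length 1. *)
Definition vanishing (R : realType) (f : R -> R) :=
  continuous f /\ forall e, 0 < e -> exists M, forall x, M < `|x| -> `|f x| < e.

(** A compact segment handles the middle. In a tail, [f] is within [e / 4] of an affine function,
    whose own increment is at most [e / 2]. *)
Lemma asymptotic_uniform_continuity (R : realType) (f : R -> R)
    (a1 b1 a2 b2 : R) :
  continuous f ->
  (forall e, 0 < e -> exists M, forall x, M < x -> `|f x - a1 * x - b1| < e) ->
  (forall e, 0 < e -> exists M, forall x, x < M -> `|f x - a2 * x - b2| < e) ->
  forall e, 0 < e -> exists2 d, 0 < d &
    forall x y, `|x - y| < d -> `|f x - f y| < e.
Proof.
move=> cf f1 f2 e e0.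
have e40 : 0 < e / 4 by rewrite divr_gt0.
have [M1 {}f1] := f1 _ e40; have [M2 {}f2] := f2 _ e40.
have [d1 d10 Ad] := compact_uniform_continuity cf (segment_compact (a:=M2 - 1) (b:=M1 + 1)) e0.
have c0 : 0 < 2 * (`|a1| + `|a2| + 1).
  by rewrite mulr_gt0 // ltr_wpDl // addr_ge0.
have far a b x y : `|a| <= `|a1| + `|a2| + 1 ->
    `|x - y| < e / (2 * (`|a1| + `|a2| + 1)) ->
    `|f x - a * x - b| < e / 4 -> `|f y - a * y - b| < e / 4 ->
    `|f x - f y| < e.
  move=> ac xy fx fy.
  have -> : f x - f y = (f x - a * x - b) - (f y - a * y - b) + a * (x - y).
    by ring.
  have axy : `|a * (x - y)| <= e / 2.
    rewrite normrM; apply: le_trans (_ : (`|a1| + `|a2| + 1) * (e / (2 * (`|a1| + `|a2| + 1))) <= _).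
      by apply: ler_pM => //; exact: ltW.
    rewrite le_eqVlt; apply/orP; left; apply/eqP; field.
    by rewrite gt_eqF //; move: c0; rewrite pmulr_rgt0.
  apply: le_lt_trans (ler_normD _ _) _.
  have := ler_normB (f x - a * x - b) (f y - a * y - b); lra.
(* The bound 1 keeps [y] in the tail of [x], as the segment overlaps each tail by 1. *)
exists (Num.min d1 (Num.min 1 (e / (2 * (`|a1| + `|a2| + 1))))).
  by rewrite !lt_min d10 ltr01 divr_gt0.
move=> x y; rewrite !lt_min => /and3P[xy1 xy2 xy3].
have [xl|xl] := ltP x (M2 - 1).
  apply: (far a2 b2) => //; [|apply: f2; lra|apply: f2].
    by rewrite -addrA addrCA lerDl addr_ge0.
  by move: xy2; rewrite ltr_norml => /andP[]; lra.
have [xr|xr] := ltP (M1 + 1) x.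
  apply: (far a1 b1) => //; [|apply: f1; lra|apply: f1].
    by rewrite -addrA lerDl addr_ge0.
  by move: xy2; rewrite ltr_norml => /andP[]; lra.
by apply: Ad => //=; rewrite in_itv /= xl xr.
Qed.

Lemma vanishing_uniform_continuity (R : realType) (f : R -> R) :
  vanishing f -> forall e, 0 < e -> exists2 d, 0 < d &
    forall x y, `|x - y| < d -> `|f x - f y| < e.
Proof.
move=> [cf f0]; apply: (@asymptotic_uniform_continuity _ f 0 0 0 0) => //.
- move=> e /f0[M fM]; exists M => x Mx.
  by rewrite mul0r !subr0; apply: fM; apply: lt_le_trans (ler_norm x).
- move=> e /f0[M fM]; exists (- M) => x xM.
  rewrite mul0r !subr0; apply: fM; rewrite -normrN.
  by apply: lt_le_trans (ler_norm _); lra.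
Qed.

Lemma vanishing_bounded (R : realType) (f : R -> R) :
  vanishing f -> exists2 B, 0 < B & forall x, `|f x| <= B.
Proof.
move=> [cf f0]; have [M fM] := f0 1 ltr01.
have M0 : - `|M| <= `|M| by rewrite (@le_trans _ _ 0) // oppr_le0.
have [c _ fc] := @EVT_max R (fun x => `|f x|) _ _ M0
  (continuous_subspaceT (fun x => cvg_norm (cf x))).
exists (1 + `|f c|); first by rewrite ltr_pwDl.
move=> x; have [xM|Mx] := leP `|x| `|M|.
  by apply: ler_wpDl => //; apply: fc; rewrite in_itv /= -ler_norml.
rewrite ler_wpDr //; apply/ltW/fM; apply: le_lt_trans Mx; exact: ler_norm.
Qed.

(** If [r * |x|] is large, both values are small; otherwise [|x|] is bounded in terms of [r] and
    uniform continuity applies. *)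
Lemma vanishing_dilation (R : realType) (f : R -> R) (r : R) :
  vanishing f -> 0 < r -> forall e, 0 < e -> exists2 d, 0 < d &
    forall s t, r <= s -> r <= t -> `|s - t| < d ->
    forall x, `|f (s * x) - f (t * x)| < e.
Proof.
move=> vf r0 e e0; have [cf f0] := vf.
have e20 : 0 < e / 2 by rewrite divr_gt0.
have [M fM] := f0 _ e20.
have [d d0 fd] := vanishing_uniform_continuity vf e0.
have M0 : 0 < `|M| + 1 by rewrite ltr_wpDl.
exists (d * r / (`|M| + 1)); first by rewrite divr_gt0 // mulr_gt0.
move=> s t rs rt st x; have [xM|xM] := leP (`|M| + 1) (r * `|x|).
  have far u : r <= u -> `|f (u * x)| < e / 2.
    move=> ru; apply: fM; rewrite normrM (gtr0_norm (lt_le_trans r0 ru)).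
    have := ler_wpM2r (normr_ge0 x) ru; have := ler_norm M; lra.
  apply: le_lt_trans (ler_normB _ _) _; have := far s rs; have := far t rt; lra.
apply: fd; rewrite -mulrBl normrM.
have [->|x0] := eqVneq x 0; first by rewrite normr0 mulr0.
apply: (@lt_trans _ _ (d * r / (`|M| + 1) * `|x|)).
  by rewrite ltr_pM2r // normr_gt0.
rewrite mulrAC ltr_pdivrMr // -mulrA ltr_pM2l //.
Qed.

(** * Derivatives and primitives *)

Lemma is_derive_affine (R : realType) (f : R -> R) (a b x d : R) :
  is_derive (a * x + b) 1 f d -> is_derive x 1 (fun y => f (a * y + b)) (a * d).
Proof.
move=> fd; rewrite mulrC.
apply: (@is_derive1_comp _ f (fun y => a * y + b)).
apply: is_derive_eq; rewrite /GRing.scale /=; ring.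
Qed.

Lemma is_derive_continuous (R : realType) (f df : R -> R) :
  (forall x : R, is_derive x 1 f (df x)) -> continuous f.
Proof.
move=> fd x; apply/differentiable_continuous/derivable1_diffP.
by have := fd x => ?; exact: ex_derive.
Qed.

(** An integral from -1 is a primitive to the right of -1, and a reflected one to the left of 1. A
    constant makes them agree on []-1, 0]], so the function glued at 0 coincides near each point
    with one of them. *)
Lemma antiderivative (R : realType) (f : R -> R) :
  continuous f -> exists F : R -> R, forall x : R, is_derive x 1 F (f x).
Proof.
have half (g : R -> R) : continuous g ->
    exists G : R -> R, forall x : R, -1 < x -> is_derive x 1 G (g x).
  move=> cg; exists (fun y => \int[lebesgue_measure]_(t in `[-1, y]) g t) => x x1.
  have xx : x < x + 1 by rewrite ltrDl.
  have [|dG G'] := @continuous_FTC1_closed R g (-1) x _ xx _ x1 (cg x).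
    apply: continuous_compact_integrable; first exact: segment_compact.
    exact: continuous_subspaceT.
  by rewrite derive1E in G'; rewrite -G'; apply: DeriveDef.
move=> cf; have [F1 dF1] := half f cf.
have [|F2 dF2] := half (fun x => - f (- x)).
  by move=> x; apply: cvgN; apply: continuous_comp; [exact: opp_continuous|exact: cf].
pose c := F1 0 - F2 0.
have dF2' (x : R) : x < 1 -> is_derive x 1 (fun y => F2 (- y) + c) (f x).
  move=> x1; have : is_derive (-1 * x + 0) 1 F2 (- f (- (-1 * x + 0))).
    by apply: dF2; lra.
  move=> /is_derive_affine; rewrite addr0 mulN1r !opprK mulN1r opprK => dF.
  have := is_deriveD dF (is_derive_cst c x 1); rewrite addr0.
  congr (is_derive _ _ _ _); apply/funext => y.
  by rewrite -[LHS]/(F2 (-1 * y + 0) + c) addr0 mulN1r.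
pose F x := if x < 0 then F2 (- x) + c else F1 x.
have F1F2 x : -1 < x -> x <= 0 -> F1 x = F2 (- x) + c.
  move=> x1; rewrite le_eqVlt => /predU1P[->|x0]; first by rewrite oppr0 /c; ring.
  have [|t _] := @MVT_is_derive _ (fun y => F1 y - (F2 (- y) + c)) (fun=> 0) _ _ x0.
    move=> t /andP[xt t0].
    have t1 : -1 < t by lra.
    have t2 : t < 1 by lra.
    by have := is_deriveB (dF1 _ t1) (dF2' _ t2); rewrite subrr.
  by rewrite oppr0 mul0r /c; lra.
exists F => x; have [x1|x1] := ltP (-1) x.
  apply: near_eq_is_derive (dF1 _ x1).
  near=> y; rewrite /F; case: ltP => // y0; apply: F1F2 (ltW y0).
  by near: y; exact: lt_nbhsr.
have x2 : x < 1 by lra.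
apply: near_eq_is_derive (dF2' _ x2).
near=> y; rewrite /F; case: ltP => // y0.
have : y < 0 by near: y; apply: lt_nbhsl; lra.
by rewrite ltNge y0.
Unshelve. all: by end_near. Qed.

(** * Averages of members of a closed subspace *)

(** The difference is the integral of [D s x] over [a <= s <= b], a uniform limit of Riemann sums
    lying in [V]. The cell errors may depend on [x]; only their mean over the [m] cells has to be
    uniformly small. *)
Lemma closed_subspace_average (R : realType) (T : Type) (V : set (T -> R))
    (a b : R) (F D : R -> T -> R) :
  closed_subspace V -> a < b ->
  (forall t, a <= t <= b -> V (D t)) ->
  (forall x (t : R), a <= t <= b -> is_derive t 1 (F^~ x) (D t x)) ->
  (forall e, 0 < e -> exists m (E : nat -> T -> R), [/\ (0 < m)%N,
     forall j s x, (j < m)%N ->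
       a + (b - a) * (j%:R / m%:R) <= s <= a + (b - a) * (j.+1%:R / m%:R) ->
       `|D s x - D (a + (b - a) * (j%:R / m%:R)) x| <= E j x &
     forall x, \sum_(j < m) E j x <= e * m%:R]) ->
  V (fun x => F b x - F a x).
Proof.
move=> cV ab VD dF H; have [_ _ VZ VC] := cV; apply: VC.
apply/uniform_closureP => e e0.
have ba : 0 < b - a by rewrite subr_gt0.
have [m [E [m0 DE sE]]] := H (e / (b - a)) (divr_gt0 e0 ba).
have m0' : 0 < m%:R :> R by rewrite ltr0n.
exists (fun x => (b - a) / m%:R *
    \sum_(j < m) D (a + (b - a) * (j%:R / m%:R)) x).
  apply: VZ; apply: closed_subspace_sum => // j _; apply: VD.
  have j0 : 0 <= j%:R / m%:R :> R by rewrite divr_ge0.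
  have j1 : j%:R / m%:R <= 1 :> R by rewrite ler_pdivrMr // mul1r ler_nat ltnW.
  rewrite lerDl mulr_ge0 //; last exact: ltW.
  by rewrite -lerBrDl ler_piMr // ltW.
move=> x; apply: le_trans (riemann_sum_error ab m0 (dF x) _) _.
  by move=> j s jm sj; apply: (DE j s x).
rewrite mulrAC ler_pdivrMr // mulrC -ler_pdivlMr // mulrAC; exact: sE.
Qed.

(** Equicontinuity in the parameter gives the constant cell error [e] once the mesh is below [d]. *)
Lemma closed_subspace_uniform_average (R : realType) (T : Type)
    (V : set (T -> R)) (a b : R) (F D : R -> T -> R) :
  closed_subspace V -> a < b ->
  (forall t, a <= t <= b -> V (D t)) ->
  (forall x (t : R), a <= t <= b -> is_derive t 1 (F^~ x) (D t x)) ->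
  (forall e, 0 < e -> exists2 d, 0 < d & forall s t,
     a <= s <= b -> a <= t <= b -> `|s - t| < d ->
     forall x, `|D s x - D t x| <= e) ->
  V (fun x => F b x - F a x).
Proof.
move=> cV ab VD dF DD; apply: closed_subspace_average VD dF _ => // e e0.
have [d d0 {}DD] := DD e e0.
have ba : 0 < b - a by rewrite subr_gt0.
pose m := (Num.truncn ((b - a) / d)).+1.
have m0 : 0 < m%:R :> R by rewrite ltr0n.
have md : (b - a) / m%:R < d.
  by rewrite ltr_pdivrMr // mulrC -ltr_pdivrMr // truncnS_gt.
exists m, (fun _ _ => e); split => //; last first.
  by move=> x; rewrite sumr_const card_ord mulr_natr.
move=> j s x jm /andP[js sj].
have j0 : 0 <= j%:R / m%:R :> R by rewrite divr_ge0 // ltW.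
have j1 : j.+1%:R / m%:R <= 1 :> R by rewrite ler_pdivrMr // mul1r ler_nat.
have tS : a + (b - a) * (j.+1%:R / m%:R) = a + (b - a) * (j%:R / m%:R) + (b - a) / m%:R.
  by field; rewrite gt_eqF.
have h0 : 0 < (b - a) / m%:R by rewrite divr_gt0.
have aj : a <= a + (b - a) * (j%:R / m%:R) by rewrite lerDl mulr_ge0 // ltW.
have jb : a + (b - a) * (j.+1%:R / m%:R) <= b.
  by rewrite -lerBrDl ler_piMr // ltW.
apply: DD.
- by rewrite (le_trans aj js) (le_trans sj jb).
- rewrite aj /=; lra.
- rewrite ger0_norm ?subr_ge0 //; lra.
Qed.

Lemma closed_subspace_continuous (R : realType) (T : topologicalType) :
  closed_subspace [set f : T -> R | continuous f].
Proof.
split.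
- by move=> x; apply: cvg_cst.
- by move=> f g cf cg x; apply: cvgD; [exact: cf|exact: cg].
- by move=> c f cf x; apply: cvgMr; exact: cf.
- move=> f /uniform_closureP Sf x; apply/cvgrPdist_lt => e e0.
  have e30 : 0 < e / 3 by rewrite divr_gt0.
  have [s cs fs] := Sf _ e30.
  have /cvgrPdist_lt/(_ _ e30) := cs x.
  apply: filterS => y sxy.
  rewrite -(subrKA (s x)) -[s x - f y](subrKA (s y)).
  have := fs x; have := fs y; rewrite distrC => fy fx.
  apply: le_lt_trans (ler_normD _ _) _.
  have := ler_normD (s x - s y) (s y - f y); lra.
Qed.

(** * Construction of a nonnegative integrable kernel *)

Definition affine_invariant (R : realType) (V : set (R -> R)) :=
  forall a b f, V f -> V (fun x => f (a * x + b)).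

(** The mean value theorem is applied to the two first differences, then to [f1] between the two
    points found; [c] is the distance of these points. *)
Lemma second_difference_MVT (R : realType) (f f1 f2 : R -> R) (k x : R) :
  0 < k ->
  (forall y : R, is_derive y 1 f (f1 y)) ->
  (forall y : R, is_derive y 1 f1 (f2 y)) ->
  exists c y, [/\ 0 < c, c < 2 * k, `|y - x| < k &
    f (x + k) - 2 * f x + f (x - k) = k * c * f2 y].
Proof.
move=> k0 df df1.
have lt1 : x < x + k by lra.
have lt2 : x - k < x by lra.
have [c1 /andP[xc1 c1x] E1] := @MVT_is_derive _ f f1 _ _ lt1.
have [c2 /andP[xc2 c2x] E2] := @MVT_is_derive _ f f1 _ _ lt2.
have lt3 : c2 < c1 by lra.
have [c3 /andP[c23 c31] E3] := @MVT_is_derive _ f1 f2 _ _ lt3.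
exists (c1 - c2), c3; split; [lra|lra| |].
  by rewrite ltr_norml; apply/andP; split; lra.
have -> : f (x + k) - 2 * f x + f (x - k) =
  (f (x + k) - f x) - (f x - f (x - k)) by ring.
rewrite E1 E2 (_ : x + k - x = k); last by ring.
by rewrite (_ : x - (x - k) = k); [rewrite -mulrBl E3; ring|ring].
Qed.

Lemma is_derive_dilation (R : realType) (f : R -> R) (a x d : R) :
  is_derive (a * x) 1 f d -> is_derive x 1 (fun y => f (a * y)) (a * d).
Proof.
rewrite -[a * x]addr0 => /is_derive_affine.
by congr (is_derive _ _ _ _); apply/funext => y; rewrite addr0.
Qed.

(* Taylor's formula with integral remainder:
   the function is the average of [(1 - s) g''(s x)] over [0 <= s <= 1]. *)
Lemma taylor_remainder_mem (R : realType) (V : set (R -> R))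
    (g g1 g2 : R -> R) :
  closed_subspace V -> affine_invariant V ->
  (forall x : R, is_derive x 1 g (g1 x)) ->
  (forall x : R, is_derive x 1 g1 (g2 x)) ->
  vanishing g2 -> V g2 ->
  V (fun x => if x == 0 then g2 0 / 2 else (g x - g 0 - g1 0 * x) / x ^+ 2).
Proof.
move=> cV aV dg dg1 vg2 Vg2; have [_ _ VZ VC] := cV.
(* Integration by parts yields this primitive of [D] in [s]; at [x = 0] the integrand is just
   [(1 - s) * g2 0]. *)
pose F s x := if x == 0 then (s - s ^+ 2 / 2) * g2 0
  else (1 - s) * (g1 (x * s) / x) + g (x * s) / x ^+ 2.
pose D s x := (1 - s) * g2 (x * s).
have dF (x s : R) : is_derive s 1 (F^~ x) (D s x).
  rewrite /F /D; have [->|x0] := eqVneq x 0.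
    eapply is_derive_eq; [typeclasses eauto|]; rewrite /GRing.scale /= mul0r; by field.
  have d1 := is_derive_dilation (dg1 (x * s)).
  have d0 := is_derive_dilation (dg (x * s)).
  by eapply is_derive_eq; [typeclasses eauto|]; rewrite /GRing.scale /=; field.
have [B B0 g2B] := vanishing_bounded vg2.
have VD s : V (D s).
  rewrite /D; apply: VZ.
  rewrite (_ : (fun _ => _) = (fun x => g2 (s * x + 0))); first exact: aV.
  by apply/funext => x; rewrite addr0 mulrC.
(* The modulus from [vanishing_dilation] needs [s] bounded away from 0. The part over [[0, r]] is at
   most [r * B] and is absorbed by closedness of [V]. *)
have VF r : 0 < r -> r < 1 -> V (fun x => F 1 x - F r x).
  move=> r0 r1; apply: (closed_subspace_uniform_average (D := D)) => //.
  move=> e e0; have e20 : 0 < e / 2 by rewrite divr_gt0.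
  have [d d0 gd] := vanishing_dilation vg2 r0 e20.
  exists (Num.min d (e / 2 / B)); first by rewrite lt_min d0 divr_gt0.
  move=> s t /andP[rs s1] /andP[rt t1]; rewrite lt_min => /andP[st1 st2] x.
  have -> : D s x - D t x =
      (1 - s) * (g2 (s * x) - g2 (t * x)) + (t - s) * g2 (t * x).
    by rewrite /D ![x * _]mulrC; ring.
  apply: le_trans (ler_normD _ _) _; rewrite [leRHS]splitr !normrM; apply: lerD.
    rewrite -[leRHS]mul1r; apply: ler_pM => //; last exact/ltW/gd.
    by rewrite ger0_norm; lra.
  rewrite distrC; apply: le_trans (_ : e / 2 / B * B <= _).
    by apply: ler_pM => //; exact: ltW.
  by rewrite divfK // gt_eqF.
apply: VC; apply/uniform_closureP => e e0.
pose r := Num.min (1 / 2) (e / B).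
have r0 : 0 < r by rewrite lt_min !divr_gt0.
have r1 : r < 1 by rewrite /r gt_min; apply/orP; left; lra.
exists (fun x => F 1 x - F r x); first exact: VF.
move=> x.
have -> : (if x == 0 then g2 0 / 2 else (g x - g 0 - g1 0 * x) / x ^+ 2) =
    F 1 x - F 0 x.
  rewrite /F; case: eqVneq => [_|x0]; first by field.
  by rewrite mulr1 mulr0; field.
have -> : F 1 x - F 0 x - (F 1 x - F r x) = F r x - F 0 x by ring.
have [c /andP[c0 cr]] := @MVT_is_derive _ (F^~ x) (D^~ x) _ _ r0.
rewrite /= => ->; rewrite subr0 normrM (gtr0_norm r0).
apply: (@le_trans _ _ (B * (e / B))); last by rewrite mulrCA divff ?mulr1 // gt_eqF.
apply: ler_pM => //; [exact: ltW| |by rewrite ge_min lexx orbT].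
rewrite /D normrM -[leRHS]mul1r; apply: ler_pM => //.
by rewrite ger0_norm; lra.
Qed.

(** Outside a segment [g] stays below [g x0], so the maximum over that segment is global. *)
Lemma vanishing_argmax (R : realType) (g : R -> R) (x0 : R) :
  vanishing g -> 0 < g x0 -> exists2 p, 0 < g p & forall x, g x <= g p.
Proof.
move=> [cg g0] gx0; have [M gM] := g0 _ gx0.
have M0 : - `|M| <= `|M| by rewrite (@le_trans _ _ 0) // oppr_le0.
have [p _ gp] := EVT_max M0 (continuous_subspaceT cg).
have x0M : `|x0| <= `|M|.
  rewrite leNgt; apply/negP => Mx; have : M < `|x0|.
    by apply: le_lt_trans Mx; exact: ler_norm.
  by move/gM; rewrite gtr0_norm // ltxx.
have gx0p : g x0 <= g p by apply: gp; rewrite in_itv /= -ler_norml.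
exists p; first exact: lt_le_trans gx0p.
move=> x; have [xM|Mx] := leP `|x| `|M|.
  by apply: gp; rewrite in_itv /= -ler_norml.
apply: le_trans gx0p; apply: le_trans (ler_norm _) _; apply/ltW/gM.
by apply: le_lt_trans Mx; exact: ler_norm.
Qed.

Lemma continuous_translate (R : realType) (f : R -> R) (b : R) :
  continuous f -> continuous (fun x => f (x + b)).
Proof.
move=> cf x; apply: (@continuous_comp _ _ _ (fun y : R => y + b) f); last exact: cf.
by apply: cvgD; [exact: cvg_id|exact: cvg_cst].
Qed.

(* Smoothing [eta] into [g] with [g''] in [V] and moving the maximum of [g] to
   the origin, the kernel is [(g 0 - g x) / x^2]. *)
Lemma nonnegative_kernel (R : realType) (V : set (R -> R)) (eta : R -> R)
    (x0 : R) :
  closed_subspace V -> affine_invariant V -> V `<=` [set f | continuous f] ->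
  V eta -> vanishing eta -> 0 < eta x0 ->
  exists k : R -> R, [/\ V k, vanishing k, forall x, 0 <= k x,
    exists y, 0 < k y & exists C, forall x, k x * x ^+ 2 <= C].
Proof.
move=> cV aV contV Veta veta eta0; have [_ VD VZ VC] := cV.
have [ceta eta_lim] := veta.
have [E1 dE1] := antiderivative ceta.
have [E dE] := antiderivative (is_derive_continuous dE1).
(* Positivity of [eta] within [h] of [x0] makes the second difference of [E] positive at [x0]. *)
have [h h0 etah] : exists2 h, 0 < h & forall y, `|y - x0| < h -> 0 < eta y.
  have /cvgrPdist_lt/(_ _ eta0)/nbhs_ballP[h h0 hh] := ceta x0.
  exists h => // y yx; have : ball x0 h y by rewrite -ball_normE /ball_ /= distrC.
  by move/hh => /=; rewrite ltr_norml => /andP[_]; lra.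
(* [diff2 E] is [eta] convolved with the tent $\max(h-|t|,0)$; its second derivative [diff2 eta] is
   a combination of translates of [eta]. *)
pose diff2 (f : R -> R) x := f (x + h) - 2 * f x + f (x - h).
have dshift (f df : R -> R) (b : R) : (forall x : R, is_derive x 1 f (df x)) ->
    forall x : R, is_derive x 1 (fun y => f (y + b)) (df (x + b)).
  move=> fdf x; have := @is_derive_affine _ f 1 b x (df (1 * x + b)) (fdf _).
  rewrite !mul1r; congr (is_derive _ _ _ _).
  by apply/funext => y; rewrite mul1r.
have ddiff2 (f df : R -> R) : (forall x : R, is_derive x 1 f (df x)) ->
    forall x : R, is_derive x 1 (diff2 f) (diff2 df x).
  move=> fdf x; have d1 := dshift _ _ h fdf x; have d2 := dshift _ _ (- h) fdf x.
  have d0 := fdf x.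
  by eapply is_derive_eq; [typeclasses eauto|]; rewrite /GRing.scale /= /diff2; ring.
have dg := ddiff2 _ _ dE; have dg1 := ddiff2 _ _ dE1.
have diff2E x := second_difference_MVT x h0 dE dE1.
have vg : vanishing (diff2 E).
  split; first exact: is_derive_continuous dg.
  move=> e e0; have hh0 : 0 < h * (2 * h) by rewrite !mulr_gt0.
  have [M etaM] := eta_lim _ (divr_gt0 e0 hh0).
  exists (M + h) => x Mx; have [c [y [c0 ch yx ]]] := diff2E x.
  rewrite -/(diff2 E x) => ->.
  rewrite normrM (gtr0_norm (mulr_gt0 h0 c0)).
  have : `|eta y| < e / (h * (2 * h)).
    apply: etaM; have := lerB_dist x (x - y); rewrite opprB addrCA subrr addr0.
    rewrite distrC in yx; have := ler_normD (x - y) y; rewrite subrK; lra.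
  rewrite ltr_pdivlMr // mulrC; apply: le_lt_trans.
  by rewrite ler_wpM2r // ler_wpM2l // ltW.
have veta2 : vanishing (diff2 eta).
  split.
    move=> x; apply: cvgD; [apply: cvgB|].
    - exact: continuous_translate.
    - by apply: cvgMr; exact: ceta.
    - exact: continuous_translate.
  move=> e e0; have e40 : 0 < e / 4 by rewrite divr_gt0.
  have [M etaM] := eta_lim _ e40; exists (M + h) => x Mx.
  have e1 : `|eta (x + h)| < e / 4.
    apply: etaM; have := ler_normB (x + h) h; rewrite addrK (gtr0_norm h0); lra.
  have e2 : `|eta (x - h)| < e / 4.
    apply: etaM; have := ler_normD (x - h) h; rewrite subrK (gtr0_norm h0); lra.
  have e3 : `|eta x| < e / 4 by apply: etaM; lra.
  move: e1 e2 e3; rewrite !ltr_norml => /andP[? ?] /andP[? ?] /andP[? ?].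
  rewrite /diff2; apply/andP; split; lra.
have gx0 : 0 < diff2 E x0.
  have [c [y [c0 ch yx ]]] := diff2E x0; rewrite -/(diff2 E x0) => ->.
  by rewrite !mulr_gt0 // etah.
have [p gp0 gp] := vanishing_argmax vg gx0.
pose g x := diff2 E (x + p); pose g1 x := diff2 E1 (x + p).
pose g2 x := diff2 eta (x + p).
have g1_0 : g1 0 = 0.
  have [||||_ Dg0] := @derive1_at_max _ g (-1) 1 0.
  - by lra.
  - move=> t _; have := dshift _ _ p dg t => ?; exact: ex_derive.
  - by rewrite in_itv /=; apply/andP; split; lra.
  - by move=> t _; rewrite /g add0r.
  - by have [_ Dg1] := dshift _ _ p dg 0; exact: etrans (esym Dg1) Dg0.
have vg2 : vanishing g2.
  have [cd vd] := veta2; split.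
    exact: continuous_translate.
  move=> e /vd[M dM]; exists (M + `|p|) => x Mx; apply: dM.
  have := ler_normB (x + p) p; rewrite addrK; lra.
have Vg2 : V g2.
  rewrite (_ : g2 = fun x => (eta (1 * x + (p + h)) + (-2) * eta (1 * x + p)) +
      eta (1 * x + (p - h))).
    exact: VD _ _ (VD _ _ (aV 1 (p + h) eta Veta)
      (VZ (-2) _ (aV 1 p eta Veta))) (aV 1 (p - h) eta Veta).
  by apply/funext => x; rewrite /g2 /diff2 !mul1r !addrA; ring.
have := taylor_remainder_mem cV aV (dshift _ _ p dg) (dshift _ _ p dg1) vg2 Vg2.
rewrite -/g -/g1 -/g2.
under eq_fun do rewrite -/(g _) -/(g1 _) -/(g2 _) g1_0 mul0r subr0.
set K := fun x : R => _ => VK.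
pose k x := -1 * K x; have Vk : V k by apply: VZ.
have ck : continuous k := contV _ Vk.
have kE x : x != 0 -> k x = (g 0 - g x) / x ^+ 2.
  by move=> x0'; rewrite /k /K (negbTE x0') mulN1r -mulNr opprB.
have gmax x : g x <= g 0 by rewrite /g add0r.
have k_ge0' x : x != 0 -> 0 <= k x.
  by move=> x0'; rewrite kE // divr_ge0 ?sqr_ge0 // subr_ge0.
(* At 0 the kernel is not given by the quotient; its sign there follows by continuity. *)
have k_ge0 x : 0 <= k x.
  have [->|/k_ge0'//] := eqVneq x 0; rewrite leNgt; apply/negP => k0.
  have := ck 0 => /cvgrPdist_lt /(_ (- k 0)); rewrite oppr_gt0 => /(_ k0).
  move/nbhs_ballP => [d d0 kd].
  have d20 : d / 2 != 0 by rewrite gt_eqF // divr_gt0.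
  have : ball 0 d (d / 2).
    rewrite -ball_normE /ball_ /= sub0r normrN gtr0_norm; last by rewrite divr_gt0.
    by rewrite /= in d0; lra.
  move/kd => /=; rewrite ltr_norml => /andP[+ _]; have := k_ge0' _ d20; lra.
have [B B0 gB] := vanishing_bounded vg.
have kC x : k x * x ^+ 2 <= g 0 + B.
  have [->|x0'] := eqVneq x 0.
    by rewrite expr0n /= mulr0 addr_ge0 ?(ltW B0) // /g add0r ltW.
  rewrite kE // divfK ?sqrf_eq0 // lerD2l.
  by apply: le_trans (ler_norm _) _; rewrite normrN; exact: gB.
have gB0 : 0 < g 0 + B by rewrite addr_gt0 // /g add0r.
exists k; split => //.
- split => // e e0; exists (Num.max 1 ((g 0 + B) / e)) => x.
  rewrite gt_max => /andP[x1 x2]; rewrite ger0_norm //.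
  have xx : 0 < `|x| by rewrite (lt_trans _ x1).
  rewrite -(ltr_pM2r (mulr_gt0 xx xx)).
  have -> : `|x| * `|x| = x ^+ 2 by rewrite -expr2 real_normK ?num_real.
  apply: le_lt_trans (kC x) _; rewrite -real_normK ?num_real // expr2.
  move: x2; rewrite ltr_pdivrMr // => x2; apply: lt_le_trans x2 _.
  by rewrite mulrC ler_pM2l // ler_pMr // ltW.
- have gp0' : 0 < g 0 by rewrite /g add0r.
  have [M gM] := vg.2 _ gp0'.
  (* Far out [g] lies strictly below its maximum [g 0]; the term [|p|] offsets the translation by
     [p]. *)
  pose y := `|M| + 1 + `|p|.
  have y0 : 0 < y by rewrite /y ltr_wpDr // ltr_wpDl.
  exists y; rewrite kE ?gt_eqF // divr_gt0 ?exprn_gt0 // subr_gt0.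
  apply: le_lt_trans (ler_norm _) _; apply: gM.
  apply: lt_le_trans (ler_norm _); rewrite /y.
  have := ler_norm M; have := ler_norm (- p); rewrite normrN; lra.
- by exists (g 0 + B).
Qed.

(** * From the kernel to a sigmoid, and approximation by steep sigmoids *)

(** [A] is a primitive of [k], bounded by the decay of [k] and rescaled to run from 0 to 1.
    Differences of its translates are averages of translates of [k], hence in [V]. *)
Lemma sigmoid_of_kernel (R : realType) (V : set (R -> R)) (k : R -> R) :
  closed_subspace V -> affine_invariant V -> V k -> vanishing k ->
  (forall x, 0 <= k x) -> (exists y, 0 < k y) ->
  (exists C, forall x, k x * x ^+ 2 <= C) ->
  exists A : R -> R, [/\ {homo A : x y / x <= y}, forall x, 0 <= A x <= 1,
    forall e, 0 < e -> exists K, forall x,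
      (K <= x -> 1 - e <= A x) /\ (x <= - K -> A x <= e) &
    forall a b c, V (fun x => A (a * x + b) - A (a * x + c))].
Proof.
move=> cV aV Vk vk k0 [y ky] [C kC].
have [ck _] := vk; have [A dA] := antiderivative ck.
have nA : {homo A : x y / x <= y}.
  move=> s t; rewrite le_eqVlt => /predU1P[->//|st].
  have [c _ E] := @MVT_is_derive _ A k _ _ st.
  by rewrite -subr_ge0 E mulr_ge0 // subr_ge0 ltW.
have C0 : 0 <= C by apply: le_trans (kC 0); rewrite expr0n mulr0.
have dB (x : R) : x != 0 -> is_derive x 1 (fun x => A x + C * x^-1) (k x - C / x ^+ 2).
  move=> x0; have d1 := @is_deriveV R id x 1 1 x0 _.
  have d2 := dA x; eapply is_derive_eq; [typeclasses eauto|].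
  by rewrite /GRing.scale /=; field.
(* Since [k x <= C / x ^+ 2], the function [A x + C / x] does not increase on either side of 0. This
   bounds [A] on both tails. *)
have tail s t : s < t -> 0 < s * t -> A t - A s <= C * (s^-1 - t^-1).
  move=> st st0.
  have nz c : s <= c <= t -> c != 0.
    move=> /andP[sc ct]; apply/eqP => c0; rewrite c0 in sc ct.
    by move: st0; rewrite ltNge mulr_le0_ge0.
  have [|c /andP[sc ct] /= E] := MVT_is_derive st (f := fun x => A x + C * x^-1)
    (df := fun x => k x - C / x ^+ 2); first by move=> x /nz; exact: dB.
  have c0 : c != 0 by apply: nz; rewrite !ltW.
  have : A t + C * t^-1 - (A s + C * s^-1) <= 0.
    rewrite E mulr_le0_ge0 //; last by rewrite subr_ge0 ltW.
    by rewrite subr_le0 ler_pdivlMr // exprn_even_gt0.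
  rewrite mulrBr; lra.
have Aub x : A x <= A 1 + C.
  have [x1|x1] := leP x 1; first by apply: le_trans (nA _ _ x1) _; rewrite lerDl.
  have := tail 1 x x1; rewrite mul1r invr1 => /(_ (lt_trans ltr01 x1)).
  have : 0 <= C * x^-1 by rewrite mulr_ge0 // invr_ge0 ltW // (lt_trans ltr01).
  rewrite mulrBr; lra.
have Alb x : A (-1) - C <= A x.
  have [x1|x1] := leP (-1) x.
    by apply: le_trans (nA _ _ x1); rewrite gerBl.
  have x0 : x < 0 by rewrite (lt_trans x1) // oppr_lt0.
  have := tail x (-1) x1; rewrite mulrN1 oppr_gt0 invrN1 => /(_ x0).
  have : 0 <= C * - x^-1 by rewrite mulr_ge0 // oppr_ge0 invr_le0 ltW.
  rewrite mulrBr; lra.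
have hs : has_sup (range A).
  by split; [exists (A 0); exists 0|exists (A 1 + C) => _ [x _ <-]].
have hi : has_inf (range A).
  by split; [exists (A 0); exists 0|exists (A (-1) - C) => _ [x _ <-]].
pose U := sup (range A); pose L := inf (range A).
have AU x : A x <= U by apply: ub_le_sup; [exact: hs.2|exists x].
have LA x : L <= A x by apply: ge_inf; [exact: hi.2|exists x].
have LU : L < U.
  have [d d0 kd] : exists2 d, 0 < d & forall z, `|z - y| < d -> 0 < k z.
    have /cvgrPdist_lt/(_ _ ky)/nbhs_ballP[d d0 hd] := ck y.
    exists d => // z zy; have : ball y d z by rewrite -ball_normE /ball_ /= distrC.
    by move/hd => /=; rewrite ltr_norml => /andP[_]; lra.
  have yd : y < y + d by rewrite ltrDl.
  have [c /andP[c1 c2] E] := @MVT_is_derive _ A k _ _ yd.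
  have kc : 0 < k c by apply: kd; rewrite ltr_norml; apply/andP; split; lra.
  have : 0 < A (y + d) - A y by rewrite E mulr_gt0 // subr_gt0.
  have := AU (y + d); have := LA y; lra.
have UL0 : 0 < U - L by rewrite subr_gt0.
have VA h : 0 < h -> V (fun x => A (x + h) - A x).
  move=> h0; rewrite (_ : (fun x => _) = fun x => A (x + h) - A (x + 0)); last first.
    by apply/funext => x; rewrite addr0.
  apply: (@closed_subspace_uniform_average _ _ V 0 h (fun t x => A (x + t))
    (fun t x => k (x + t))) => //.
  - move=> t _; rewrite (_ : (fun x => _) = fun x => k (1 * x + t)); first exact: aV.
    by apply/funext => x; rewrite mul1r.
  - move=> x t _; have := @is_derive_affine _ A 1 x t (k (1 * t + x)) (dA _).
    rewrite !mul1r addrC; congr (is_derive _ _ _ _).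
    by apply/funext => z; rewrite mul1r addrC.
  - move=> e e0; have [d d0 kd] := vanishing_uniform_continuity vk e0.
    exists d => // s t _ _ st x; apply/ltW/kd.
    by rewrite opprD addrACA subrr add0r.
have VA' b c : V (fun x => A (x + b) - A (x + c)).
  have [V0 _ VZ _] := cV; have [bc|cb|->] := ltgtP b c.
  - have h0 : 0 < c - b by rewrite subr_gt0.
    rewrite (_ : (fun x => _) =
      fun x => -1 * (A (1 * x + b + (c - b)) - A (1 * x + b))).
      exact: VZ _ _ (aV 1 b _ (VA _ h0)).
    by apply/funext => x; rewrite mul1r mulN1r opprB (_ : x + b + (c - b) = x + c) //; ring.
  - have h0 : 0 < b - c by rewrite subr_gt0.
    rewrite (_ : (fun x => _) = fun x => A (1 * x + c + (b - c)) - A (1 * x + c)).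
      exact: aV 1 c _ (VA _ h0).
    by apply/funext => x; rewrite mul1r (_ : x + c + (b - c) = x + b) //; ring.
  - by rewrite (_ : (fun x => _) = fun=> 0) //; apply/funext => x; rewrite subrr.
exists (fun x => (A x - L) / (U - L)); split.
- by move=> s t /nA st; rewrite ler_pM2r ?invr_gt0 // lerD2r.
- move=> x; rewrite divr_ge0 ?subr_ge0 ?(ltW LU) //=.
  by rewrite ler_pdivrMr // mul1r lerD2r.
- move=> e e0; have e0' : 0 < e * (U - L) by rewrite mulr_gt0.
  have [_ [s _ <-]] := sup_adherent e0' hs; rewrite -/U => sU.
  have [_ [t _ <-]] := inf_adherent e0' hi; rewrite -/L => tL.
  exists (Num.max s (- t)) => x; rewrite ge_max; split.
    move=> /andP[/nA sx _]; rewrite ler_pdivlMr // mulrBl mul1r; lra.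
  move=> xt; have /nA : x <= t.
    by apply: le_trans xt _; rewrite lerNl le_max lexx orbT.
  rewrite ler_pdivrMr //; lra.
- move=> a b c; have [_ _ VZ _] := cV.
  rewrite (_ : (fun x => _) =
      fun x => (U - L)^-1 * (A (a * x + 0 + b) - A (a * x + 0 + c))).
    exact: VZ _ _ (aV a 0 _ (VA' b c)).
  by apply/funext => x; rewrite addr0 -mulrBl mulrC; congr (_ * _); ring.
Qed.

(** Differences [chi j] of steep sigmoids at consecutive nodes are nonnegative and sum almost to 1
    on [[-M, M]]. Weighting them by the values of [f] at the nodes approximates [f]: near nodes by
    uniform continuity, far ones because [chi j] is tiny there. *)
Lemma sigmoid_dense (R : realType) (V : set (R -> R)) (A f : R -> R) :
  closed_subspace V -> {homo A : x y / x <= y} -> (forall x, 0 <= A x <= 1) ->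
  (forall e, 0 < e -> exists K, forall x,
      (K <= x -> 1 - e <= A x) /\ (x <= - K -> A x <= e)) ->
  (forall a b c, V (fun x => A (a * x + b) - A (a * x + c))) ->
  vanishing f -> V f.
Proof.
move=> cV nA A01 Alim VA vf; have [_ _ VZ VC] := cV; apply: VC.
apply/uniform_closureP => e e0.
have e40 : 0 < e / 4 by rewrite divr_gt0.
have [B B0 fB] := vanishing_bounded vf.
have [d d0 fd] := vanishing_uniform_continuity vf e40.
have [M' fM'] := vf.2 _ e40; pose M := `|M'|.
have M0 : 0 <= M by exact: normr_ge0.
have fM x : M < `|x| -> `|f x| < e / 4.
  by move=> Mx; apply: fM'; apply: le_lt_trans Mx; exact: ler_norm.
(* With the margin 1, points with [|x| <= M] are at distance at least 1 from both ends, so a slope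
   of at least [K] saturates the end sigmoids. *)
pose L := M + 1; have L0 : 0 < L by rewrite ltr_wpDl.
pose m := (Num.truncn (2 * L / (d / 2))).+1.
have m0 : 0 < m%:R :> R by rewrite ltr0n.
pose h := 2 * L / m%:R.
have h0 : 0 < h by rewrite !divr_gt0 // mulr_gt0.
have d20 : 0 < d / 2 by rewrite divr_gt0.
have hd : h < d / 2.
  by rewrite /h ltr_pdivrMr // [d / 2 * _]mulrC -ltr_pdivrMr // truncnS_gt.
pose t (j : nat) := - L + j%:R * h.
have tS j : t j.+1 = t j + h by rewrite /t -natr1; ring.
have tm : t m = L.
  by rewrite /t /h mulrCA divff ?gt_eqF // mulr1; lra.
(* Up to [m] far terms, each at most [2 * B * e2], then add up to at most [e / 4]. *)
pose e2 := e / (8 * B * m%:R).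
have e20 : 0 < e2 by rewrite divr_gt0 // !mulr_gt0.
have [K' AK'] := Alim _ e20; pose K := `|K'| + 1.
have K0 : 0 < K by rewrite ltr_wpDl.
have AKr x : K <= x -> 1 - e2 <= A x.
  by move=> Kx; apply: (AK' x).1; have := ler_norm K'; rewrite /K in Kx; lra.
have AKl x : x <= - K -> A x <= e2.
  by move=> Kx; apply: (AK' x).2; have := ler_norm K'; rewrite /K in Kx; lra.
(* This slope saturates [A] at the distances 1 and [d / 2]. As [h < d / 2], a node at distance [d]
   from [x] has its successor at distance at least [d / 2]. *)
pose N := Num.max K (K / (d / 2)).
have NK : K <= N by rewrite le_max lexx.
have NKd : K <= N * (d / 2) by rewrite -ler_pdivrMr // le_max lexx orbT.
have N0 : 0 < N by rewrite (lt_le_trans K0).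
pose chi (j : nat) x := A (N * (x - t j)) - A (N * (x - t j.+1)).
have Vchi j : V (chi j).
  rewrite (_ : chi j = fun x => A (N * x + (- N * t j)) - A (N * x + (- N * t j.+1))).
    exact: VA.
  by apply/funext => x; rewrite /chi !mulrBr !mulNr.
have chi0 j x : 0 <= chi j x.
  by rewrite subr_ge0 nA // ler_wpM2l ?(ltW N0) // lerD2l lerN2 tS lerDl ltW.
have chi_sum x : \sum_(j < m) chi j x = A (N * (x + L)) - A (N * (x - L)).
  rewrite -(big_mkord xpredT (fun j => chi j x)).
  rewrite (telescope_sumr_eq (fun j => - A (N * (x - t j)))) //; last first.
    by move=> j _; rewrite /chi opprK addrC.
  by rewrite tm /t mul0r addr0 !opprK addrC.
have chi_sum1 x : \sum_(j < m) chi j x <= 1.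
  rewrite chi_sum; have /andP[_ h1] := A01 (N * (x + L)).
  have /andP[h2 _] := A01 (N * (x - L)); lra.
exists (fun x => \sum_(j < m) f (t j) * chi j x).
  by apply: closed_subspace_sum => // j _; exact: VZ.
move=> x.
have -> : f x - \sum_(j < m) f (t j) * chi j x =
    f x * (1 - \sum_(j < m) chi j x) + \sum_(j < m) (f x - f (t j)) * chi j x.
  rewrite mulrBr mulr1 mulr_sumr -addrA; congr (_ + _).
  by rewrite -!sumrN -big_split /=; apply: eq_bigr => j _; ring.
have far j : d <= `|x - t j| -> chi j x <= e2.
  move=> dx; have /andP[A0 _] := A01 (N * (x - t j.+1)).
  have /andP[_ A1] := A01 (N * (x - t j)).
  have [xt|xt] := leP 0 (x - t j).
    rewrite ger0_norm // in dx.
    have /AKr : K <= N * (x - t j.+1).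
      apply: le_trans NKd _; rewrite ler_pM2l //; rewrite tS; lra.
    rewrite /chi; lra.
  rewrite ltr0_norm // in dx.
  have /AKl : N * (x - t j) <= - K.
    have := ler_wpM2l (ltW N0) dx; have : N * (d / 2) <= N * d by rewrite ler_pM2l //; lra.
    rewrite mulrN; lra.
  rewrite /chi; lra.
have Bme : 2 * B * (m%:R * e2) = e / 4.
  by rewrite /e2; field; rewrite !gt_eqF.
have Be : 2 * B * e2 <= e / 4.
  rewrite -Bme ler_pM2l ?mulr_gt0 // ler_peMl ?(ltW e20) //.
  by rewrite ler1n.
have part1 : `|f x * (1 - \sum_(j < m) chi j x)| <= e / 4.
  have s0 : 0 <= 1 - \sum_(j < m) chi j x by rewrite subr_ge0.
  have s1 : 1 - \sum_(j < m) chi j x <= 1 by rewrite gerBl sumr_ge0.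
  rewrite normrM (ger0_norm s0); have [xM|Mx] := leP `|x| M; last first.
    by rewrite -[leRHS]mulr1; apply: ler_pM => //; exact/ltW/fM.
  apply: le_trans Be; rewrite [2 * B]mulrC -mulrA; apply: ler_pM => //.
  move: xM; rewrite ler_norml => /andP[x1 x2].
  have /AKr : K <= N * (x + L).
    by apply: le_trans NK _; rewrite ler_peMr ?(ltW N0) // /L; lra.
  have /AKl : N * (x - L) <= - K.
    rewrite -[leLHS]opprK lerN2 -mulrN; apply: le_trans NK _.
    by rewrite ler_peMr ?(ltW N0) // /L; lra.
  rewrite chi_sum; lra.
have part2 : `|\sum_(j < m) (f x - f (t j)) * chi j x| <= e / 4 + e / 4.
  apply: le_trans (ler_norm_sum _ _ _) _.
  apply: (@le_trans _ _ (\sum_(j < m) (e / 4 * chi j x + 2 * B * e2))).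
    apply: ler_sum => j _; rewrite normrM (ger0_norm (chi0 j x)).
    have [dx|xd] := leP d `|x - t j|; last first.
      apply: ler_wpDr; first by have := mulr_gt0 B0 e20; lra.
      by rewrite ler_wpM2r // ltW // fd.
    apply: ler_wpDl; first by rewrite mulr_ge0 // ltW.
    apply: ler_pM => //; [|exact: far].
    apply: le_trans (ler_normB _ _) _; have := fB x; have := fB (t j); lra.
  rewrite big_split /= -mulr_sumr sumr_const card_ord; apply: lerD.
    by rewrite -[leRHS]mulr1 ler_pM2l.
  rewrite -[_ *+ m]mulr_natr (_ : _ * m%:R = 2 * B * (m%:R * e2)); last by ring.
  by rewrite Bme.
apply: le_trans (ler_normD _ _) _; lra.
Qed.

(** * Density in one variable *)

Definition univariate_ridges (R : realType) (phi : R -> R) : set (R -> R) :=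
  [set g | exists a b, g = fun x => phi (a * x + b)].

(** Second differences cancel the affine asymptotes, so every [eta h] vanishes at infinity; a
    nonzero one feeds the kernel and sigmoid constructions. *)
Lemma univariate_density (R : realType) (phi : R -> R) (a1 b1 a2 b2 : R) :
  continuous phi ->
  ~ (exists a b, forall x, phi x = a * x + b) ->
  (forall e, 0 < e -> exists M, forall x, M < x -> `|phi x - a1 * x - b1| < e) ->
  (forall e, 0 < e -> exists M, forall x, x < M -> `|phi x - a2 * x - b2| < e) ->
  @vanishing R `<=` closed_span (univariate_ridges phi).
Proof.
move=> cphi naff phi1 phi2 f vf.
set V := closed_span _; have cV : closed_subspace V := closed_span_subspace _.
have aV : affine_invariant V.
  move=> a b g Vg.
  apply: (closed_span_min (closed_subspace_comp (fun x => a * x + b) cV) _ Vg).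
  move=> _ [c [d ->]] /=; apply: sub_closed_span; exists (c * a), (c * b + d).
  by apply/funext => x /=; congr phi; ring.
have contV : V `<=` [set g | continuous g].
  apply: closed_span_min; first exact: closed_subspace_continuous.
  move=> _ [a [b ->]] x /=; apply: (@continuous_comp _ _ _ (fun x => a * x + b) phi).
    by apply: cvgD; [apply: cvgMr; exact: cvg_id|exact: cvg_cst].
  exact: cphi.
have Vphi a b : V (fun x => phi (a * x + b)).
  by apply: sub_closed_span; exists a, b.
pose eta h x := phi (x + h) - 2 * phi x + phi (x - h).
have Veta c h : V (fun x => c * eta h x).
  have [_ VD VZ _] := cV; apply: (VZ c).
  rewrite (_ : eta h = fun x => (phi (1 * x + h) + (-2) * phi (1 * x + 0)) +
      phi (1 * x + (- h))).
    exact: VD _ _ (VD _ _ (Vphi _ _) (VZ (-2) _ (Vphi _ _))) (Vphi _ _).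
  by apply/funext => x; rewrite /eta !mul1r addr0; ring.
have veta c h : vanishing (fun x => c * eta h x).
  split; first exact: contV.
  move=> e e0; have c0 : 0 < 4 * (`|c| + 1) by rewrite mulr_gt0 // ltr_wpDl.
  have e'0 := divr_gt0 e0 c0.
  have [M1 p1] := phi1 _ e'0; have [M2 p2] := phi2 _ e'0.
  (* The term [|h|] keeps [x - h], [x] and [x + h] in the same tail. *)
  exists (`|M1| + `|M2| + `|h|) => x xM.
  have bound a b : `|phi (x + h) - a * (x + h) - b| < e / (4 * (`|c| + 1)) ->
      `|phi x - a * x - b| < e / (4 * (`|c| + 1)) ->
      `|phi (x - h) - a * (x - h) - b| < e / (4 * (`|c| + 1)) ->
      `|c * eta h x| < e.
    move=> h1 h2 h3.
    have : `|eta h x| < 4 * (e / (4 * (`|c| + 1))).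
      have -> : eta h x = (phi (x + h) - a * (x + h) - b)
         - 2 * (phi x - a * x - b) + (phi (x - h) - a * (x - h) - b).
        by rewrite /eta; ring.
      move: h1 h2 h3; rewrite !ltr_norml => /andP[? ?] /andP[? ?] /andP[? ?].
      by apply/andP; split; lra.
    have -> : 4 * (e / (4 * (`|c| + 1))) = e / (`|c| + 1).
      by field; rewrite gt_eqF // ltr_wpDl.
    rewrite ltr_pdivlMr ?ltr_wpDl // mulrDr mulr1 normrM mulrC.
    by apply: le_lt_trans; rewrite lerDl.
  have n1 := ler_norm M1; have n2 := ler_norm M2; have n3 := ler_norm h.
  have n4 := ler_norm (- h); have n5 := ler_norm (- M2).
  rewrite !normrN in n4 n5.
  have [x0|x0] := leP 0 x.
    rewrite (ger0_norm x0) in xM; have := normr_ge0 M2; have := normr_ge0 h => ? ?.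
    by apply: (bound a1 b1); apply: p1; lra.
  rewrite (ltr0_norm x0) in xM; have := normr_ge0 M1; have := normr_ge0 h => ? ?.
  by apply: (bound a2 b2); apply: p2; lra.
have [h [x etax]] : exists h x, eta h x != 0.
  (* Otherwise, letting [h] tend to infinity in [eta h x = eta h 0] shows that
     [phi] is affine. *)
  apply: contrapT => H; have eta0 h x : eta h x = 0.
    by apply: contrapT => /eqP E; apply: H; exists h, x.
  apply: naff; exists ((a1 + a2) / 2), (phi 0) => x.
  apply/eqP; rewrite -subr_eq0 -normr_le0; apply/ler_addgt0Pr => e e0.
  rewrite add0r; have e40 : 0 < e / 4 by rewrite divr_gt0.
  have [M1 p1] := phi1 _ e40; have [M2 p2] := phi2 _ e40.
  pose h := `|M1| + `|M2| + `|x| + 1.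
  have n1 := ler_norm M1; have n2 := ler_norm M2; have n3 := ler_norm x.
  have n4 := ler_norm (- x); have n5 := ler_norm (- M2).
  rewrite !normrN in n4 n5.
  have := normr_ge0 M1; have := normr_ge0 M2; have := normr_ge0 x => ? ? ?.
  have q1 : `|phi (x + h) - a1 * (x + h) - b1| < e / 4 by apply: p1; rewrite /h; lra.
  have q2 : `|phi (0 + h) - a1 * (0 + h) - b1| < e / 4 by apply: p1; rewrite /h; lra.
  have q3 : `|phi (x - h) - a2 * (x - h) - b2| < e / 4 by apply: p2; rewrite /h; lra.
  have q4 : `|phi (0 - h) - a2 * (0 - h) - b2| < e / 4 by apply: p2; rewrite /h; lra.
  have E1 := eta0 h x; have E2 := eta0 h 0; rewrite /eta in E1 E2.
  (* [phi x] and [phi 0] are the means of the values at [x + h], [x - h] and at [h], [- h], where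
     the asymptotes apply; the terms in [h] cancel. *)
  have -> : phi x - ((a1 + a2) / 2 * x + phi 0) =
     ((phi (x + h) - a1 * (x + h) - b1) - (phi (0 + h) - a1 * (0 + h) - b1)
      + (phi (x - h) - a2 * (x - h) - b2) - (phi (0 - h) - a2 * (0 - h) - b2)) / 2.
    have -> : phi x = (phi (x + h) + phi (x - h)) / 2 by lra.
    have -> : phi 0 = (phi (0 + h) + phi (0 - h)) / 2 by lra.
    by field.
  move: q1 q2 q3 q4; rewrite !ltr_norml ler_norml.
  move=> /andP[? ?] /andP[? ?] /andP[? ?] /andP[? ?].
  by apply/andP; split; lra.
(* Scaling [eta h] by the constant [eta h x] makes its value at [x] positive, whatever the sign
   was. *)
have eta_pos : 0 < eta h x * eta h x by rewrite -expr2 exprn_even_gt0.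
have [k [Vk vk k0 ky kC]] :=
  nonnegative_kernel cV aV contV (Veta (eta h x) h) (veta (eta h x) h) eta_pos.
have [A [nA A01 Alim VA]] := sigmoid_of_kernel cV aV Vk vk k0 ky kC.
exact: sigmoid_dense cV nA A01 Alim VA vf.
Qed.

(** * Ridge functions and affine forms in several variables *)

(** Written as the generators of the first layer, so that [closed_span (ridges n phi)] is
    convertible to the closure of [networks phi n 1]. *)
Definition ridges (R : realType) (n : nat) (phi : R -> R) :
    set ('rV[R]_n -> R) :=
  [set g | exists (a : 'rV[R]_n) (b : R), g = (fun x => phi (dotv a x + b))].
Arguments ridges {R} n phi.

Definition affine_form (R : realType) (n : nat) (u : 'rV[R]_n -> R) :=
  exists (a : 'rV[R]_n) (b : R), u = (fun x => dotv a x + b).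

Lemma dotv_lin (R : realType) (n : nat) (c d : R) (a a' x : 'rV[R]_n) :
  dotv (c *: a + d *: a') x = c * dotv a x + d * dotv a' x.
Proof.
rewrite /dotv !mulr_sumr -big_split /=; apply: eq_bigr => i _.
by rewrite !mxE; ring.
Qed.

Lemma affine_form_lin (R : realType) (n : nat) (u v : 'rV[R]_n -> R)
    (c d b : R) :
  affine_form u -> affine_form v ->
  affine_form (fun x => c * u x + d * v x + b).
Proof.
move=> [a [b1 ->]] [a' [b2 ->]].
exists (c *: a + d *: a'), (c * b1 + d * b2 + b); apply/funext => x.
by rewrite dotv_lin; ring.
Qed.

Lemma affine_form_coord (R : realType) (n : nat) (i : 'I_n) :
  affine_form (fun x : 'rV[R]_n => x 0 i).
Proof.
exists (delta_mx 0 i), 0; apply/funext => x.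
rewrite addr0 /dotv (bigD1 i) //= big1 ?addr0 ?mxE ?eqxx ?mul1r //.
by move=> j ji; rewrite mxE eqxx (negbTE ji) mul0r.
Qed.

(** Lifts one-variable density to several variables: [phi (c * u x + d)] is again a ridge
    function. *)
Lemma closed_span_ridges (R : realType) (n : nat) (phi f : R -> R)
    (u : 'rV[R]_n -> R) :
  affine_form u -> closed_span (univariate_ridges phi) f ->
  closed_span (ridges n phi) (f \o u).
Proof.
move=> au.
apply: (closed_span_min (closed_subspace_comp u (closed_span_subspace _))).
move=> _ [c [d ->]] /=; apply: sub_closed_span.
have [a [b E]] := affine_form_lin c 0 d au au.
exists a, b; apply/funext => x /=; congr phi.
by rewrite -[RHS]/((fun x => dotv a x + b) x) -E; ring.
Qed.

(** * The function $1/(1+t^2)$, its conjugate, and products of two ridge functions *)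

Section witch.
Variable R : realType.
Implicit Types s t : R.

(** The witch of Agnesi, up to a constant the Poisson kernel of the half-plane at height 1;
    [conjugate_witch] is the conjugate Poisson kernel. *)
Definition witch t : R := (1 + t ^+ 2)^-1.

Definition conjugate_witch t : R := t / (1 + t ^+ 2).

Definition dconjugate_witch t : R := (1 - t ^+ 2) / (1 + t ^+ 2) ^+ 2.

Lemma onesqr_gt0 t : 0 < 1 + t ^+ 2.
Proof. by rewrite ltr_pwDl // sqr_ge0. Qed.

Lemma onesqr_neq0 t : 1 + t ^+ 2 != 0.
Proof. by rewrite gt_eqF // onesqr_gt0. Qed.

Lemma witch_gt0 t : 0 < witch t.
Proof. by rewrite invr_gt0 onesqr_gt0. Qed.

Lemma witch_le1 t : witch t <= 1.
Proof. by rewrite invf_le1 ?onesqr_gt0 // lerDl sqr_ge0. Qed.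

Lemma is_derive_witch t : is_derive t 1 witch (- (2 * t) / (1 + t ^+ 2) ^+ 2).
Proof.
have d1 : is_derive t 1 (fun t => 1 + t ^+ 2) (2 * t).
  by eapply is_derive_eq; [typeclasses eauto|]; rewrite /GRing.scale /=; ring.
apply: (is_derive_eq (@is_deriveV _ _ t _ 1 (onesqr_neq0 t) d1)).
by rewrite /GRing.scale /=; field; exact: onesqr_neq0.
Qed.

Lemma is_derive_conjugate_witch t :
  is_derive t 1 conjugate_witch (dconjugate_witch t).
Proof.
have d1 := is_derive_witch t.
have -> : conjugate_witch = (fun t => t * witch t) by [].
eapply is_derive_eq; [typeclasses eauto|].
rewrite /GRing.scale /= /witch /dconjugate_witch.
by field; exact: onesqr_neq0.
Qed.

Lemma is_derive_dconjugate_witch t :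
  is_derive t 1 dconjugate_witch (2 * t * (t ^+ 2 - 3) / (1 + t ^+ 2) ^+ 3).
Proof.
have d1 := is_derive_witch t.
have -> : dconjugate_witch = (fun t => (1 - t ^+ 2) * (witch t * witch t)).
  by apply/funext => s; rewrite /dconjugate_witch /witch; field; exact: onesqr_neq0.
eapply is_derive_eq; [typeclasses eauto|].
rewrite /GRing.scale /= /witch.
by field; exact: onesqr_neq0.
Qed.

Lemma atan_le s t : s <= t -> atan s <= atan t.
Proof.
rewrite le_eqVlt => /predU1P[->//|st].
have [c _ E] := @MVT_is_derive _ atan (fun t => (1 + t ^+ 2)^-1) _ _ st.
rewrite -subr_ge0 E mulr_ge0 // ?subr_ge0 ?(ltW st) //; exact/ltW/witch_gt0.
Qed.

(* [dconjugate_witch] has finite total variation: its derivative is dominated by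
   [3 / (1 + t^2)]. *)
Lemma dconjugate_witch_variation s t : s <= t ->
  `|dconjugate_witch t - dconjugate_witch s| <= 3 * (atan t - atan s).
Proof.
rewrite le_eqVlt => /predU1P[->|st]; first by rewrite !subrr normr0 mulr0.
(* The values [c = 1] and [c = -1] give the two halves of the absolute value bound. *)
have main c : `|c| = 1 ->
    c * (dconjugate_witch t - dconjugate_witch s) <= 3 * (atan t - atan s).
  move=> c1.
  have [|z _] := MVT_is_derive st
    (f := fun t => 3 * atan t - c * dconjugate_witch t)
    (df := fun t => 3 * (1 + t ^+ 2)^-1
       - c * (2 * t * (t ^+ 2 - 3) / (1 + t ^+ 2) ^+ 3)).
    move=> x _; have d1 := is_derive1_atan x.
    have d2 := is_derive_dconjugate_witch x.
    by eapply is_derive_eq; [typeclasses eauto|]; rewrite /GRing.scale /=; ring.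
  suff : 0 <= 3 * (1 + z ^+ 2)^-1 - c * (2 * z * (z ^+ 2 - 3) / (1 + z ^+ 2) ^+ 3).
    move=> /mulr_ge0 /(_ (_ : 0 <= t - s)) h E.
    by have := h (ltW _); rewrite subr_gt0 => /(_ st); rewrite -E; lra.
  have -> : 3 * (1 + z ^+ 2)^-1 - c * (2 * z * (z ^+ 2 - 3) / (1 + z ^+ 2) ^+ 3) =
      (3 * (1 + z ^+ 2) ^+ 2 - c * (2 * z * (z ^+ 2 - 3))) / (1 + z ^+ 2) ^+ 3.
    by field; exact: onesqr_neq0.
  rewrite divr_ge0 //; last by rewrite exprn_ge0 // ltW // onesqr_gt0.
  have c2 : c ^+ 2 = 1 by rewrite -[c ^+ 2]real_normK ?num_real // c1 expr1n.
  (* A sum of squares, plus a multiple of [1 - c ^+ 2], which is 0. *)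
  have -> : 3 * (1 + z ^+ 2) ^+ 2 - c * (2 * z * (z ^+ 2 - 3)) =
     3 * (z + c) ^+ 2 + z ^+ 2 * ((z - c) ^+ 2 + 2 * z ^+ 2 + 2)
     + (3 + z ^+ 2) * (1 - c ^+ 2) by ring.
  rewrite c2 subrr mulr0 addr0.
  have h1 : 0 <= (z - c) ^+ 2 + 2 * z ^+ 2 + 2.
    by have := sqr_ge0 (z - c); have := sqr_ge0 z; lra.
  have h2 := mulr_ge0 (sqr_ge0 z) h1; have := sqr_ge0 (z + c); lra.
rewrite ler_norml; apply/andP; split.
  by have := main (-1) (normrN1 _); lra.
by have := main 1 (normr1 _); rewrite mul1r.
Qed.

Lemma witch_continuous : continuous witch.
Proof. exact: is_derive_continuous is_derive_witch. Qed.

Lemma witch_small e : 0 < e -> exists M, forall t, M < `|t| -> witch t < e.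
Proof.
move=> e0; exists (1 + e^-1) => t Mt.
have e'0 : 0 < e^-1 by rewrite invr_gt0.
have t1 : 1 < `|t| by lra.
rewrite /witch -[ltRHS]invrK ltf_pV2 ?posrE ?onesqr_gt0 //.
rewrite -[t ^+ 2]real_normK ?num_real // expr2.
have : `|t| <= `|t| * `|t| by rewrite ler_peMr // ltW.
lra.
Qed.

Lemma witch_vanishing : vanishing witch.
Proof.
split; first exact: witch_continuous.
by move=> e /witch_small[M wM]; exists M => t /wM; rewrite gtr0_norm // witch_gt0.
Qed.

Lemma dconjugate_witch_vanishing : vanishing dconjugate_witch.
Proof.
split; first exact: is_derive_continuous is_derive_dconjugate_witch.
move=> e /witch_small[M wM]; exists M => t /wM; apply: le_lt_trans.
have -> : dconjugate_witch t = (1 - t ^+ 2) * witch t * witch t.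
  by rewrite /dconjugate_witch /witch; field; exact: onesqr_neq0.
rewrite normrM [in leLHS](gtr0_norm (witch_gt0 t)) ler_piMl ?(ltW (witch_gt0 t)) //.
rewrite normrM [in leLHS](gtr0_norm (witch_gt0 t)) /witch.
rewrite ler_pdivrMr ?onesqr_gt0 // mul1r ler_norml.
by have := sqr_ge0 t => ?; apply/andP; split; lra.
Qed.

Lemma witch_not_affine : ~ (exists a b, forall t, witch t = a * t + b).
Proof.
move=> [a [b E]]; have := E 0; have := E 1; have := E (-1).
rewrite /witch sqrrN expr1n expr0n /= addr0 invr1.
have : (1 + 1)^-1 * 2 = 1 :> R by rewrite (_ : 1 + 1 = 2) ?mulVf //; ring.
lra.
Qed.

(** [witch] is not affine and has zero asymptotes, so one-variable density applies to it; this makes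
    [dconjugate_witch] and the tents available. *)
Lemma witch_density : @vanishing R `<=` closed_span (univariate_ridges witch).
Proof.
apply: (@univariate_density _ witch 0 0 0 0); first exact: witch_continuous.
- exact: witch_not_affine.
- move=> e /witch_vanishing.2[M wM]; exists M => x Mx.
  by rewrite mul0r !subr0; apply: wM; apply: lt_le_trans (ler_norm x).
- move=> e /witch_vanishing.2[M wM]; exists (- M) => x xM.
  rewrite mul0r !subr0; apply: wM; rewrite -normrN.
  by apply: lt_le_trans (ler_norm _); lra.
Qed.

End witch.

(* The divided difference of [t / (1 + t^2)] at [u, v] is
   [(1 - u v) / ((1 + u^2) (1 + v^2))] and also the average of the ridge
   functions [dconjugate_witch (v + s (u - v))] over [0 <= s <= 1].  The finite
   variation of [dconjugate_witch] makes the Riemann sums converge uniformly. *)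
Lemma divided_difference_mem (R : realType) (n : nat) (u v : 'rV[R]_n -> R) :
  affine_form u -> affine_form v ->
  closed_span (ridges n (@witch R))
    (fun x => (1 - u x * v x) * (witch (u x) * witch (v x))).
Proof.
move=> au av; set V := closed_span _.
have cV : closed_subspace V by exact: closed_span_subspace.
(* A primitive of [D] in [s]; the divided difference degenerates to a derivative where
   [u x = v x]. *)
pose F s x := if u x == v x then s * dconjugate_witch (v x)
  else conjugate_witch (v x + (u x - v x) * s) / (u x - v x).
pose D s x := dconjugate_witch (v x + (u x - v x) * s).
rewrite (_ : (fun x => _) = fun x => F 1 x - F 0 x); last first.
  apply/funext => x; rewrite /F; case: eqVneq => [->|uv].
    by rewrite mul1r mul0r subr0 /dconjugate_witch /witch; field; exact: onesqr_neq0.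
  rewrite mulr1 mulr0 addr0 (_ : v x + (u x - v x) = u x); last by ring.
  rewrite /conjugate_witch /witch.
  by field; rewrite !onesqr_neq0 subr_eq0 uv.
apply: (@closed_subspace_average R _ V 0 1 F D cV ltr01).
- move=> s _; apply: (closed_span_ridges (f := @dconjugate_witch R)
    (u := fun x => v x + (u x - v x) * s)).
    rewrite (_ : (fun x => _) = fun x => s * u x + (1 - s) * v x + 0).
      exact: affine_form_lin.
    by apply/funext => x; ring.
  exact/witch_density/dconjugate_witch_vanishing.
- move=> x s _; rewrite /F /D; case: eqVneq => [->|uv].
    eapply is_derive_eq; [typeclasses eauto|].
    by rewrite /GRing.scale /= subrr mul0r addr0; ring.
  have := is_derive_conjugate_witch (v x + (u x - v x) * s).
  rewrite [v x + _]addrC => /is_derive_affine d1.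
  have -> : (fun s => conjugate_witch (v x + (u x - v x) * s) / (u x - v x)) =
     (fun s => conjugate_witch ((u x - v x) * s + v x) / (u x - v x)).
    by apply/funext => r; rewrite addrC.
  eapply is_derive_eq; [typeclasses eauto|].
  by rewrite /GRing.scale /=; field; rewrite subr_eq0.
(* The points [p j x] are monotone in [j], so the cell errors sum to at most [3 * pi] for every [x],
   however large [u x - v x] is. *)
move=> e e0; pose m := (Num.truncn (3 * pi / e)).+1.
have m0 : 0 < m%:R :> R by rewrite ltr0n.
have me : 3 * pi <= e * m%:R.
  by rewrite [e * _]mulrC -ler_pdivrMr // ltW // truncnS_gt.
(* The shape [0 + (1 - 0) * _] matches the nodes of [closed_subspace_average] on [[0, 1]]. *)
pose p (j : nat) x := v x + (u x - v x) * (0 + (1 - 0) * (j%:R / m%:R)).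
exists m, (fun j x => 3 * `|atan (p j.+1 x) - atan (p j x)|); split => //.
- move=> j s x _ /andP[js sj]; rewrite /D -/(p j x).
  have [y0|y0] := leP 0 (u x - v x).
    have h1 : p j x <= v x + (u x - v x) * s by rewrite lerD2l ler_wpM2l.
    have h2 : v x + (u x - v x) * s <= p j.+1 x by rewrite lerD2l ler_wpM2l.
    apply: le_trans (dconjugate_witch_variation h1) _; rewrite ler_pM2l //.
    by apply: le_trans (ler_norm _); rewrite lerD2r atan_le.
  have h1 : v x + (u x - v x) * s <= p j x by rewrite lerD2l ler_wnM2l // ltW.
  have h2 : p j.+1 x <= v x + (u x - v x) * s by rewrite lerD2l ler_wnM2l // ltW.
  rewrite distrC; apply: le_trans (dconjugate_witch_variation h1) _.
  rewrite ler_pM2l // distrC; apply: le_trans (ler_norm _).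
  by rewrite lerD2l lerN2 atan_le.
- move=> x; apply: le_trans me; rewrite -mulr_sumr ler_pM2l //.
  have bound a b : atan a - atan b <= pi :> R.
    have := atan_gtNpi2 b; have := atan_ltpi2 a; lra.
  have pS j : p j.+1 x = p j x + (u x - v x) / m%:R.
    by rewrite /p -natr1; field; rewrite gt_eqF.
  have [y0|y0] := leP 0 (u x - v x).
    rewrite (eq_bigr (fun j : 'I_m => atan (p j.+1 x) - atan (p j x))).
      by rewrite -(big_mkord xpredT (fun j => atan (p j.+1 x) - atan (p j x))) telescope_sumr.
    move=> j _; rewrite ger0_norm // subr_ge0 atan_le // pS lerDl.
    by rewrite divr_ge0 // ltW.
  rewrite (eq_bigr (fun j : 'I_m => - atan (p j.+1 x) - - atan (p j x))).
    rewrite -(big_mkord xpredT (fun j => - atan (p j.+1 x) - - atan (p j x))) telescope_sumr //.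
    by rewrite opprK addrC.
  move=> j _; rewrite ler0_norm; first by ring.
  rewrite subr_le0 atan_le // pS gerDl.
  by rewrite mulr_le0_ge0 ?invr_ge0 // ltW.
Qed.

(** The factors [1 - u v] and [1 + u v], obtained from [v] and [- v], add up to 2. *)
Lemma witch_mul_mem (R : realType) (n : nat) (u v : 'rV[R]_n -> R) :
  affine_form u -> affine_form v ->
  closed_span (ridges n (@witch R)) (fun x => witch (u x) * witch (v x)).
Proof.
move=> au av; have [_ VD VZ _] := closed_span_subspace (ridges n (@witch R)).
have av' : affine_form (fun x => -1 * v x + 0 * v x + 0) by exact: affine_form_lin.
have := VZ (1 / 2) _ (VD _ _ (divided_difference_mem au av)
  (divided_difference_mem au av')).
congr (closed_span _ _); apply/funext => x.
rewrite (_ : -1 * v x + 0 * v x + 0 = - v x); last by ring.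
by rewrite {4}/witch sqrrN -/(witch (v x)); field.
Qed.

(** * The closed span of the witch ridge functions is an algebra *)

Lemma closed_subspace_bounded (R : realType) (T : Type) :
  closed_subspace [set f : T -> R | exists B, forall x, `|f x| <= B].
Proof.
split.
- by exists 0 => x; rewrite normr0.
- move=> f g [B fB] [C gC]; exists (B + C) => x.
  by apply: le_trans (ler_normD _ _) _; rewrite lerD.
- move=> c f [B fB]; exists (`|c| * B) => x.
  by rewrite normrM ler_wpM2l.
- move=> f /uniform_closureP Sf; have [s [B sB] fs] := Sf 1 ltr01.
  exists (1 + B) => x; rewrite -(subrK (s x) (f x)).
  by apply: le_trans (ler_normD _ _) _; rewrite lerD.
Qed.

(** Multiplication by a bounded function preserves uniform limits. *)
Lemma closed_subspace_mul (R : realType) (T : Type) (V : set (T -> R))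
    (h : T -> R) :
  closed_subspace V -> (exists B, forall x, `|h x| <= B) ->
  closed_subspace [set f | V (fun x => h x * f x)].
Proof.
move=> [V0 VD VZ VC] [B hB]; split => /=.
- by rewrite (_ : (fun x => _) = fun=> 0) //; apply/funext => x; rewrite mulr0.
- move=> f g Vf Vg; have := VD _ _ Vf Vg; congr V.
  by apply/funext => x; rewrite mulrDr.
- move=> c f Vf; have := VZ c _ Vf; congr V.
  by apply/funext => x; rewrite mulrCA.
- move=> f /uniform_closureP Sf; apply: VC; apply/uniform_closureP => e e0.
  have B0 : 0 < `|B| + 1 by rewrite ltr_wpDl.
  have [s Vs fs] := Sf _ (divr_gt0 e0 B0).
  exists (fun x => h x * s x) => // x; rewrite -mulrBr normrM.
  apply: (@le_trans _ _ ((`|B| + 1) * (e / (`|B| + 1)))).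
    apply: ler_pM => //; apply: le_trans (hB x) _.
    by apply: le_trans (ler_norm B) _; rewrite lerDl.
  by rewrite mulrCA divff ?mulr1 // gt_eqF.
Qed.

Section witch_algebra.
Variables (R : realType) (n : nat).
Let V := closed_span (ridges n (@witch R)).

Lemma witch_span_bounded f : V f -> exists B, forall x, `|f x| <= B.
Proof.
move: f; apply: closed_span_min; first exact: closed_subspace_bounded.
move=> _ [a [b ->]]; exists 1 => x.
by rewrite gtr0_norm ?witch_le1 // witch_gt0.
Qed.

(** Bilinear extension from generators: first in [g] with [f] fixed, then in [f] with the generator
    fixed. *)
Lemma witch_span_mul f g : V f -> V g -> V (fun x => f x * g x).
Proof.
move=> Vf; have bf := witch_span_bounded Vf.
move: g; apply: (closed_span_min (closed_subspace_mul (closed_span_subspace _) bf)).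
move=> _ [a [b ->]] /=.
have bw : exists B, forall x, `|witch (dotv a x + b)| <= B.
  by exists 1 => x; rewrite gtr0_norm ?witch_le1 // witch_gt0.
rewrite (_ : (fun x => _) = fun x => witch (dotv a x + b) * f x); last first.
  by apply/funext => x; rewrite mulrC.
move: f Vf {bf}; apply: (closed_span_min (closed_subspace_mul (closed_span_subspace _) bw)).
move=> _ [c [d ->]] /=.
apply: (witch_mul_mem (u := fun x => dotv a x + b) (v := fun x => dotv c x + d)).
  by exists a, b.
by exists c, d.
Qed.

Lemma witch_span_prod (I : Type) (r : seq I) (F : I -> 'rV[R]_n -> R) :
  (forall i, V (F i)) -> V (fun x => \prod_(i <- r) F i x).
Proof.
move=> VF; elim: r => [|i r IH].
  (* The empty product is the constant 1, which is [witch] of the zero form. *)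
  apply: sub_closed_span; exists 0, 0; apply/funext => x.
  rewrite big_nil /witch /dotv big1 => [|j _]; last by rewrite mxE mul0r.
  by rewrite addr0 expr0n /= addr0 invr1.
rewrite (_ : (fun x => _) = fun x => F i x * \prod_(i <- r) F i x).
  exact: witch_span_mul.
by apply/funext => x; rewrite big_cons.
Qed.

End witch_algebra.

(** * Tents and their partition of unity on a segment *)

Section tents.
Variable R : realType.
Implicit Types t x : R.

Definition clamp t : R := Num.max 0 (Num.min t 1).

Lemma clamp_ge0 t : 0 <= clamp t. Proof. by rewrite le_max lexx. Qed.

Lemma clamp_le1 t : clamp t <= 1.
Proof. by rewrite ge_max ler01 ge_min lexx orbT. Qed.

Lemma clamp_eq0 t : t <= 0 -> clamp t = 0.
Proof. by move=> t0; apply/max_idPl; rewrite ge_min t0. Qed.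

Lemma clamp_eq1 t : 1 <= t -> clamp t = 1.
Proof. by move=> t1; rewrite /clamp (min_idPr t1); apply/max_idPr. Qed.

Lemma clamp_le x t : x <= t -> clamp x <= clamp t.
Proof. by move=> xt; rewrite /clamp; apply: le_max2 => //; exact: le_min2. Qed.

Lemma clamp_continuous : continuous clamp.
Proof.
move=> t; apply: (@continuous_max R R (cst 0) (id \min cst 1) t).
  exact: cvg_cst.
by apply: (@continuous_min R R id (cst 1) t); [exact: cvg_id|exact: cvg_cst].
Qed.

(** The hat function on [[-1, 1]] with peak 1 at 0, written so that sums of its integer translates
    telescope. *)
Definition tent t : R := clamp (t + 1) - clamp t.

Lemma tent_ge0 t : 0 <= tent t.
Proof. by rewrite subr_ge0 clamp_le // lerDl. Qed.

Lemma tent_eq0 t : 1 <= `|t| -> tent t = 0.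
Proof.
rewrite ler_normr => /orP[t1|t1].
  by rewrite /tent !clamp_eq1 ?subrr //; lra.
by rewrite /tent !clamp_eq0 ?subrr //; lra.
Qed.

Lemma tent_continuous : continuous tent.
Proof.
move=> t; apply: cvgB; last exact: clamp_continuous.
exact: (continuous_translate clamp_continuous).
Qed.

Lemma tent_vanishing : vanishing tent.
Proof.
split; first exact: tent_continuous.
by move=> e e0; exists 1 => t /ltW /tent_eq0 ->; rewrite normr0.
Qed.

(** For [0 <= t <= m] the right-hand side is [1 - 0]. *)
Lemma sum_tent (m : nat) t :
  \sum_(k < m.+1) tent (t - k%:R) = clamp (t + 1) - clamp (t - m%:R).
Proof.
rewrite -(big_mkord xpredT (fun k => tent (t - k%:R))).
rewrite (telescope_sumr_eq (fun k => - clamp (t - k%:R + 1))) //.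
  by rewrite subr0 opprK addrC -natr1; congr (_ - clamp _); ring.
move=> k _; rewrite /tent opprK addrC; congr (- clamp _ + _).
by rewrite -natr1; ring.
Qed.

End tents.

(** * Approximation of $C_0(\mathbb R^n)$ by products of tents *)

Lemma C0_scale (R : realType) (n : nat) (c : R) (f : 'rV[R]_n -> R) :
  C0 R n f -> C0 R n (fun x => c * f x).
Proof.
move=> [cf f0]; split.
  by have [_ _ Z _] := closed_subspace_continuous R 'rV[R]_n; exact: Z c f cf.
move=> e e0; have c0 : 0 < `|c| + 1 by rewrite ltr_wpDl.
have [M fM] := f0 _ (divr_gt0 e0 c0); exists M => x /fM.
rewrite ltr_pdivlMr // normrM mulrC; apply: le_lt_trans.
by rewrite ler_wpM2r // lerDl.
Qed.

Lemma coord_le_enorm (R : realType) (n : nat) (x : 'rV[R]_n) (j : 'I_n) :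
  `|x 0 j| <= enorm x.
Proof.
rewrite -sqrtr_sqr ler_sqrt /dotv.
  by rewrite (bigD1 j) //= -expr2 lerDl sumr_ge0 // => i _; rewrite -expr2 sqr_ge0.
by apply: sumr_ge0 => i _; rewrite -expr2 sqr_ge0.
Qed.

Lemma box_compact (R : realType) (n : nat) (L : R) :
  compact [set x : 'rV[R]_n | forall j, `|x 0 j| <= L].
Proof.
have := @rV_compact R n (fun=> `[- L, L]%classic) (fun=> segment_compact (a:=-L) (b:=L)).
congr compact; apply/seteqP; split=> x /= xL j; have := xL j;
  by rewrite /= in_itv /= ler_norml.
Qed.

(* Products of tents form a partition of unity on the cube [-L, L]^n. *)
Lemma C0_witch_span (R : realType) (n : nat) :
  C0 R n `<=` closed_span (ridges n (@witch R)).
Proof.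
move=> f [cf f0]; set V := closed_span _.
have cV : closed_subspace V := closed_span_subspace _.
have [_ _ VZ VC] := cV; apply: VC; apply/uniform_closureP => e e0.
have e20 : 0 < e / 2 by rewrite divr_gt0.
have [M fM] := f0 _ e20; pose L := `|M| + 1.
have L0 : 0 < L by rewrite ltr_wpDl.
pose box := [set x : 'rV[R]_n | forall j, `|x 0 j| <= L].
have [d d0 fd] := compact_uniform_continuity cf (box_compact (n:=n) (L:=L)) e20.
have out x : ~ box x -> `|f x| < e / 2.
  move=> /existsNP[j /negP]; rewrite -ltNge => Lx; apply: fM.
  have := coord_le_enorm x j; have := ler_norm M; rewrite /L in Lx; lra.
pose N := (Num.truncn (L / d)).+1.
have N0 : 0 < N%:R :> R by rewrite ltr0n.
pose h := L / N%:R; have h0 : 0 < h by rewrite divr_gt0.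
have hd : h < d by rewrite /h ltr_pdivrMr // [d * _]mulrC -ltr_pdivrMr // truncnS_gt.
pose m := (N + N)%N.
(* [T k] is the hat of half-width [h] around [node k]; as [N * h = L], these [2 N + 1] nodes run
   from [- L] to [L]. *)
pose T (k : 'I_m.+1) (s : R) := tent (s / h + N%:R - k%:R).
pose node (k : 'I_m.+1) : R := (k%:R - N%:R) * h.
pose J := {ffun 'I_n -> 'I_m.+1}.
pose chi (a : J) (x : 'rV[R]_n) := \prod_(j < n) T (a j) (x 0 j).
pose pt (a : J) : 'rV[R]_n := \row_j node (a j).
have VT k j : V (fun x => T k (x 0 j)).
  apply: (closed_span_ridges (f := @tent R)
      (u := fun x : 'rV[R]_n => x 0 j / h + N%:R - k%:R)).
    rewrite (_ : (fun x => _) = fun x : 'rV[R]_n =>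
      h^-1 * x 0 j + 0 * x 0 j + (N%:R - k%:R)).
      by apply: affine_form_lin; exact: affine_form_coord.
    by apply/funext => x; ring.
  exact/witch_density/tent_vanishing.
have chi0 a x : 0 <= chi a x by apply: prodr_ge0 => j _; exact: tent_ge0.
have sumT s : \sum_k T k s = clamp (s / h + N%:R + 1) - clamp (s / h + N%:R - m%:R).
  exact: sum_tent.
have chi_sum x : \sum_(a : J) chi a x = \prod_(j < n) \sum_k T k (x 0 j).
  by rewrite bigA_distr_bigA.
have sumT0 s : 0 <= \sum_k T k s by apply: sumr_ge0 => k _; exact: tent_ge0.
have sumT1 s : \sum_k T k s <= 1.
  rewrite sumT; have := clamp_ge0 (s / h + N%:R - m%:R).
  have := clamp_le1 (s / h + N%:R + 1); lra.
have chi_sum0 x : 0 <= \sum_a chi a x by apply: sumr_ge0 => a _.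
have chi_sum1 x : \sum_a chi a x <= 1.
  by rewrite chi_sum; apply: Num.Theory.prodr_ile1 => j _; rewrite sumT0 sumT1.
have chi_box x : box x -> \sum_a chi a x = 1.
  move=> xL; rewrite chi_sum big1 // => j _; rewrite sumT.
  have : `|x 0 j / h| <= N%:R.
    rewrite normrM normfV (gtr0_norm h0) ler_pdivrMr // /h mulrCA divff ?gt_eqF //.
    by rewrite mulr1; exact: xL.
  rewrite ler_norml => /andP[x1 x2].
  rewrite clamp_eq1; last by lra.
  by rewrite clamp_eq0 ?subr0 // /m natrD; lra.
have ptbox a : box (pt a).
  move=> j; rewrite mxE /node normrM (gtr0_norm h0) /h mulrA ler_pdivrMr // mulrC.
  rewrite ler_pM2l // ler_norml; have : (a j)%:R <= m%:R :> R by rewrite ler_nat -ltnS.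
  have : 0 <= (a j)%:R :> R by [].
  by rewrite /m natrD => ? ?; apply/andP; split; lra.
(* A nonzero product has no zero factor, so each coordinate of [x] is within [h < d] of that of
   [pt a]; the norm here is the maximum norm. *)
have near_pt a x : chi a x != 0 -> `|f x - f (pt a)| < e / 2.
  move=> /prodf_neq0 chix; rewrite distrC; apply: fd; first exact: ptbox.
  have : ball (pt a) d x.
    split=> // i j; rewrite ord1 mxE -ball_normE /ball_ /=.
    apply: lt_trans hd; rewrite ltNge; apply/negP => hx.
    have /negP := chix j isT; apply; apply/eqP/tent_eq0.
    have -> : x 0 j / h + N%:R - (a j)%:R = (x 0 j - node (a j)) / h.
      by rewrite /node; field; rewrite gt_eqF.
    by rewrite normrM normfV (gtr0_norm h0) ler_pdivlMr // mul1r distrC.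
  by rewrite -ball_normE.
exists (fun x => \sum_a f (pt a) * chi a x).
  apply: closed_subspace_sum => // a _; apply: VZ.
  by apply: witch_span_prod => j; exact: VT.
move=> x.
have -> : f x - \sum_a f (pt a) * chi a x =
    f x * (1 - \sum_a chi a x) + \sum_a (f x - f (pt a)) * chi a x.
  rewrite mulrBr mulr1 mulr_sumr -addrA; congr (_ + _).
  by rewrite -!sumrN -big_split /=; apply: eq_bigr => a _; ring.
rewrite [leRHS]splitr; apply: le_trans (ler_normD _ _) _; apply: lerD.
  have [xb|xb] := pselect (box x).
    by rewrite chi_box // subrr mulr0 normr0 ltW.
  rewrite normrM -[leRHS]mulr1; apply: ler_pM => //; first exact/ltW/out.
  by rewrite ger0_norm ?subr_ge0 // gerBl.
apply: le_trans (ler_norm_sum _ _ _) _.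
apply: (@le_trans _ _ (\sum_a e / 2 * chi a x)).
  apply: ler_sum => a _; rewrite normrM (ger0_norm (chi0 a x)).
  have [->|/near_pt fx] := eqVneq (chi a x) 0; first by rewrite !mulr0.
  by rewrite ler_wpM2r // ltW.
by rewrite -mulr_sumr -[leRHS]mulr1 ler_pM2l.
Qed.

(** * Density for networks of every depth *)

Theorem theorem2p1 (R : realType) (n l : nat) (phi : R -> R)
    (hn : (0 < n)%N) (hl : (0 < l)%N)
    (phi_cont : continuous phi)
    (phi_not_affine : ~ exists a b : R, forall x : R, phi x = a * x + b)
    (phi_asymp : exists a1 b1 a2 b2 : R,
       ((fun x : R => phi x - a1 * x - b1) @ +oo --> (0 : R)) /\
       ((fun x : R => phi x - a2 * x - b2) @ -oo --> (0 : R))) :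
  C0 R n `<=` uniform_closure (networks phi n l).
Proof.
have [a1 [b1 [a2 [b2 [asymp1 asymp2]]]]] := phi_asymp.
have phi1 e : 0 < e -> exists M, forall x, M < x -> `|phi x - a1 * x - b1| < e.
  move: asymp1 => /cvgrPdist_lt H /H[M [_ HM]].
  by exists M => x /HM; rewrite sub0r normrN.
have phi2 e : 0 < e -> exists M, forall x, x < M -> `|phi x - a2 * x - b2| < e.
  move: asymp2 => /cvgrPdist_lt H /H[M [_ HM]].
  by exists M => x /HM; rewrite sub0r normrN.
have density := univariate_density phi_cont phi_not_affine phi1 phi2.
have unif := asymptotic_uniform_continuity phi_cont phi1 phi2.
(* From here [l] counts the layers beyond the first, so the base case is one layer. *)
case: l hl => // l _; elim: l => [|l IH] f C0f.
  apply: (closed_span_min (closed_span_subspace (ridges n phi)) _ (C0_witch_span C0f)).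
  move=> _ [a [b ->]]; apply: (closed_span_ridges (f := @witch R)
    (u := fun x => dotv a x + b)); first by exists a, b.
  exact/density/witch_vanishing.
set S := [set g | exists (f : 'rV[R]_n -> R) (b : R),
  networks phi n l.+1 f /\ g = (fun x => phi (f x + b))].
rewrite -[uniform_closure _]/(closed_span S).
(* Boundedness of [f] is read off from its membership in the witch span. *)
have [B fB] := witch_span_bounded (C0_witch_span C0f).
(* [g] vanishes at infinity and is the identity on the range of [f]. *)
pose g t := t * clamp (`|B| + 1 - `|t|).
have vg : vanishing g.
  split.
    move=> t; apply: cvgM; first exact: cvg_id.
    apply: (@continuous_comp _ _ _ (fun t => `|B| + 1 - `|t|) (@clamp R)).
      by apply: cvgB; [exact: cvg_cst|apply: cvg_norm; exact: cvg_id].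
    exact: clamp_continuous.
  move=> e e0; exists (`|B| + 1) => t tB.
  by rewrite /g clamp_eq0 ?mulr0 ?normr0 //; lra.
have -> : f = g \o f.
  apply/funext => x; rewrite /= /g clamp_eq1 ?mulr1 //.
  have := fB x; have := ler_norm B; lra.
(* As [g] is a uniform limit of combinations of [phi (a * t + b)], it is enough to treat
   [phi (a * f x + b)]. *)
apply: (closed_span_min (closed_subspace_comp f (closed_span_subspace S)) _ (density _ vg)).
move=> _ [a [b ->]] /=; have [_ _ _ VC] := closed_span_subspace S; apply: VC.
apply/uniform_closureP => e e0; have [d d0 phid] := unif e e0.
have d20 : 0 < d / 2 by rewrite divr_gt0.
(* The induction hypothesis is applied to [a * f], again in $C_0(\mathbb R^n)$; uniform continuity
   of [phi] carries the error through the outer layer. *)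
have /uniform_closureP /(_ _ d20)[s Ns fs] := IH _ (C0_scale a C0f).
exists (fun x => phi (s x + b)); first by apply: sub_closed_span; exists s, b.
move=> x; apply/ltW/phid; have := fs x.
by rewrite opprD addrACA subrr addr0; lra.
Qed.
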